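(* Let $A\in K(H)^+$. Then $$E(\mathscr V(A))=\begin{cases}\{B\in\mathscr D\cap K(H)^+\mid s(B)\prec s(A)\}\setminus\mathscr L_1 & \text{if }\operatorname{Tr}(A)=\infty,\\ \{B\in\mathscr D\cap K(H)^+\mid s(B)\preccurlyeq s(A)\} & \text{if }\operatorname{Tr}(A)<\infty.\end{cases}$$
   Context: $H$ is a complex separable infinite-dimensional Hilbert space with a fixed orthonormal basis $\{e_k\}_{k\in\mathbb N}$; $B(H)$ is the algebra of bounded operators, $K(H)$ the ideal of compact operators, $K(H)^+$ its positive elements, $\mathscr L_1$ the trace class, $\operatorname{Tr}$ the usual trace. $\mathscr D$ is the algebra of operators that are diagonal with respect to $\{e_k\}$, and $E:B(H)\to\mathscr D$ sends an operator to its main diagonal (the normal faithful trace-preserving conditional expectation). $R_A$ denotes the range projection of $A$. The partial isometry orbit of $A$ is $\mathscr V(A):=\{VAV^*\mid V\in B(H)\text{ a partial isometry},\ V^*V=R_A\vee R_{A^*}\}$, and $E(\mathscr V(A))$ is its image under $E$. For compact $A$, $s(A)$ is the nonincreasing sequence of singular numbers of $A$, repeated according to multiplicity, with infinitely many zeros added if $A$ has finite rank. $\mathrm{c}_{\mathrm{o}}^*$ is the cone of nonnegative nonincreasing sequences converging to $0$; for $\xi,\eta\in \mathrm{c}_{\mathrm{o}}^*$, $\xi\prec\eta$ means $\sum_{j=1}^n\xi_j\le\sum_{j=1}^n\eta_j$ for every $n$, and $\xi\preccurlyeq\eta$ means $\xi\prec\eta$ and $\liminf_n\sum_{j=1}^n(\eta_j-\xi_j)=0$.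 *)

(* Defs.v *)
From HB Require Import structures.
From mathcomp Require Import all_boot all_order all_algebra.
From mathcomp Require Import complex sesquilinear.
From mathcomp Require Import all_classical all_reals all_analysis.

Set Implicit Arguments.
Unset Strict Implicit.
Unset Printing Implicit Defensive.

Import Order.TTheory GRing.Theory Num.Theory.
Import numFieldNormedType.Exports.

Local Open Scope classical_set_scope.
Local Open Scope ring_scope.
Local Open Scope complex_scope.

Section HilbertOperators.
Context {R : realType} {H : completeNormedModType R[i]}.

(* The scalar product of a Hilbert space: a positive definite hermitian form,
   linear in its first argument, that induces the (complete) norm of H. *)
Definition hilbert_dot (dot : {dot H for (@Num.conj R[i])}) : Prop :=
  forall x : H, `|x| ^+ 2 = dot x x.

Variable dot : {dot H for (@Num.conj R[i])}.

Definition orthonormal_basis (e : nat -> H) : Prop :=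
  (forall i j, dot (e i) (e j) = (i == j)%:R) /\
  (forall x, series (fun k => dot x (e k) *: e k) @ \oo --> x).

Definition bounded_op : set (H -> H) :=
  [set T | linear T /\ exists M : R, forall x, `|T x| <= M%:C * `|x| ].

Definition compact_op : set (H -> H) :=
  [set T | bounded_op T /\ precompact (T @` [set x | `|x| <= 1])].

(* In R[i], 0 <= z means that z is real and nonnegative. *)
Definition positive_op : set (H -> H) :=
  [set T | bounded_op T /\ forall x, 0 <= dot (T x) x].

Definition compact_pos : set (H -> H) := compact_op `&` positive_op.

(* The objects below that exist uniquely are picked with xget, whose first
   argument is an irrelevant default value. *)
Definition adjoint (T : H -> H) : H -> H :=
  xget (fun=> 0)
    [set S | bounded_op S /\ forall x y, dot (T x) y = dot x (S y)].

Definition abs_op (T : H -> H) : H -> H :=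
  xget (fun=> 0) [set S | positive_op S /\ S \o S = adjoint T \o T].

Definition projection : set (H -> H) :=
  [set P | [/\ bounded_op P, P \o P = P & adjoint P = P]].

Definition proj_onto (M : set H) : H -> H :=
  xget (fun=> 0) [set P | projection P /\ range P = M].

Definition range_proj (T : H -> H) : H -> H := proj_onto (closure (range T)).

Definition proj_join (P Q : H -> H) : H -> H :=
  proj_onto (closure [set x + y | x in range P & y in range Q]).

Definition partial_isometry : set (H -> H) :=
  [set V | bounded_op V /\
     forall x, (forall y, V y = 0 -> dot x y = 0) -> `|V x| = `|x| ].

Definition orbit_pi (A : H -> H) : set (H -> H) :=
  [set V \o A \o adjoint V | V in [set V | partial_isometry V /\
     adjoint V \o V = proj_join (range_proj A) (range_proj (adjoint A))]].

Definition diagonal_op (e : nat -> H) : set (H -> H) :=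
  [set T | bounded_op T /\ forall i j, i <> j -> dot (T (e j)) (e i) = 0].

Definition cond_exp (e : nat -> H) (T : H -> H) : H -> H :=
  fun x => limn (series (fun k => (dot (T (e k)) (e k) * dot x (e k)) *: e k)).

(* Only meant for positive T, whose diagonal entries are nonnegative reals. *)
Definition trace_op (e : nat -> H) (T : H -> H) : \bar R :=
  \sum_(0 <= k <oo) (complex.Re (dot (T (e k)) (e k)))%:E.

Definition trace_class (e : nat -> H) : set (H -> H) :=
  [set T | bounded_op T /\ (trace_op e (abs_op T) < +oo)%E].

Definition has_dim (M : set H) (n : nat) : Prop :=
  exists b : 'I_n -> H, (forall i, M (b i)) /\
    forall x, M x -> exists! c : {ffun 'I_n -> R[i]}, x = \sum_i c i *: b i.

Definition co_star : set (R ^nat) :=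
  [set xi | [/\ forall n, 0 <= xi n, nonincreasing_seq xi & xi @ \oo --> (0 : R)]].

(* For compact T: every lambda > 0 occurs as often as its multiplicity as an
   eigenvalue of |T|, which determines the sequence. The value 0 thus occurs
   only when |T| has finitely many positive eigenvalues, and then as padding. *)
Definition sing (T : H -> H) : R ^nat :=
  xget (fun=> 0) [set s | co_star s /\
    forall lambda : R, 0 < lambda -> exists2 m : nat,
      ([set k | s k = lambda] #= `I_m)%card &
      has_dim [set x | abs_op T x = lambda%:C *: x] m].

End HilbertOperators.

Definition majorized {R : realType} (xi eta : R ^nat) : Prop :=
  forall n, \sum_(0 <= j < n) xi j <= \sum_(0 <= j < n) eta j.

(* The liminf is taken in \bar R, as the partial sums may be unbounded. *)
Definition strongly_majorized {R : realType} (xi eta : R ^nat) : Prop :=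
  majorized xi eta /\
  limn_einf (fun n => (\sum_(0 <= j < n) (eta j - xi j))%:E) = 0%E.

(* Main.v *)
(** Write A = sum_j s_j f_j (x) f_j with f_j orthonormal. The orbit of A consists
    of the operators sum_j s_j g_j (x) g_j with g_j orthonormal, whose diagonal
    entries are d_k = sum_j s_j |<g_j, e_k>|^2. The matrix |<g_j, e_k>|^2 has
    column sums 1 and row sums at most 1; hence the rearrangement of d is
    majorized by s, and d and s have the same sum.

    Conversely, once the target diagonal is rearranged into a nonincreasing xi,
    one needs a real matrix U with orthonormal columns such that
    xi_i = sum_j s_j U_ij^2. Its rows are produced one at a time. If eta are the
    eigenvalues of the compression of diag s to the complement of the previous
    rows and eta_m >= xi_i >= eta_(m+1), a rotation of the corresponding two
    eigenvectors gives a row with value xi_i and leaves the eigenvalue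
    eta_m + eta_(m+1) - xi_i; majorization is preserved. The columns are
    orthonormal in the limit as soon as the top eigenvalue eta_0 tends to 0. If
    eta_0 remains at least xi + c along this process, then
    sum_(j < n) (eta_j - xi_j) >= c for all n >= 1. This is impossible when the
    liminf of these sums vanishes. When the sum of xi is infinite, it leaves
    enough room to rotate the top eigenvector with eigenvectors of much smaller
    eigenvalue, which decreases eta_0 by a fixed proportion; this is repeated. *)

Require Import Defs.
From HB Require Import structures.
From mathcomp Require Import all_boot all_order all_algebra finmap.
From mathcomp Require Import complex sesquilinear.
From mathcomp Require Import all_classical all_reals all_analysis.
From mathcomp Require Import zify ring lra.

Set Implicit Arguments.
Unset Strict Implicit.
Unset Printing Implicit Defensive.

Import Order.TTheory GRing.Theory Num.Theory.
Import numFieldNormedType.Exports.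
Local Open Scope ring_scope.

(** Every stage arises by finitely many rotations, so all relations hold exactly for long enough
    finite sums; estimates enter only in the limit. There, the squared mass D that the chosen rows
    still miss in column p satisfies s_p D^2 <= eta_0. This is effective exactly where s_p > 0; at
    the other indices the operator side carries the zero vector, which also treats finite and
    infinite rank together. The obstacle is the top eigenvalue: a greedy rotation touches only the
    two neighbours of its target, so eta_0 may never move. Spreading lowers eta_0, but it consumes
    slack in the majorization, breaks the sorting, and acts on one eigenvalue while many may lie
    near the top. Hence an induction on the number of eigenvalues above 15/16 of a fixed bound. The
    constant comes from a gap of eta_0/4: once the xi are small, rows of total at least 3/16 eta_0
    fit into it, each lowers the top by half of its value, and the top falls to at most 29/32
    eta_0. *)

Definition ultimately (P : nat -> Prop) := exists N, forall M, (N <= M)%N -> P M.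

Lemma ultimately_and (P Q : nat -> Prop) :
  ultimately P -> ultimately Q -> ultimately (fun n => P n /\ Q n).
Proof.
move=> [N1 H1] [N2 H2]; exists (maxn N1 N2) => M; rewrite geq_max => /andP[h1 h2].
by split; [apply: H1 | apply: H2].
Qed.

Lemma ultimately_mono (P Q : nat -> Prop) : (forall n, P n -> Q n) -> ultimately P -> ultimately Q.
Proof. by move=> PQ [N H]; exists N => M /H /PQ. Qed.

Lemma ultimately_ge N : ultimately (fun M => (N <= M)%N).
Proof. by exists N. Qed.

Lemma ultimately_all (P : nat -> nat -> Prop) m :
  (forall i, ultimately (P i)) -> ultimately (fun n => forall i, (i < m)%N -> P i n).
Proof.
move=> H; elim: m => [|m IHm]; first by exists 0.
apply: ultimately_mono (ultimately_and IHm (H m)) => n [h1 h2] i.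
by rewrite ltnS leq_eqVlt => /orP[/eqP ->|/h1].
Qed.

Lemma ultimately_ex P : ultimately P -> exists n, P n.
Proof. by move=> [N H]; exists N; exact: H. Qed.

Lemma ultimately_shift (P : nat -> Prop) : ultimately P -> ultimately (fun M => P M.+1).
Proof. by move=> [N H]; exists N => M h; apply: H; rewrite ltnW. Qed.

(** * Partial sums of merged and cyclically shifted sequences *)

Section Sums.
Context {R : realType}.
Implicit Types (g eta xi : nat -> R).

(** Entry [a] is overwritten and entry [b] deleted: this is what a rotation of the pair leaves
    behind. Polymorphic because eigenvalues and eigenvectors undergo the same operation. *)
Definition merge {T : Type} (a b : nat) (y : T) (g : nat -> T) (j : nat) : T :=
  if j == a then y else g (bump b j).

(** The cycle that moves entry 0 to position [p]; it re-sorts a sequence of which only the first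
    entry is out of place. *)
Definition rot_front (p j : nat) : nat :=
  if (j < p)%N then j.+1 else if j == p then 0 else j.

Lemma sum_merge_small a b y g n : (n <= a)%N -> (a < b)%N ->
  \sum_(0 <= j < n) merge a b y g j = \sum_(0 <= j < n) g j.
Proof.
move=> na ab; rewrite !big_nat; apply: eq_bigr => i /andP[_ ia].
rewrite /merge ifF; last by lia.
by congr g; rewrite /bump; lia.
Qed.

Lemma sum_merge_mid a b y g n : (a < n)%N -> (n <= b)%N ->
  \sum_(0 <= j < n) merge a b y g j = \sum_(0 <= j < n) g j - g a + y.
Proof.
elim: n => // n IHn; rewrite ltnS leq_eqVlt => /orP[/eqP <-|an] nb.
  by rewrite !big_nat_recr //= sum_merge_small // /merge eqxx addrK.
rewrite !big_nat_recr //= IHn //; last by lia.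
rewrite /merge ifF; last by lia.
have -> : bump b n = n by rewrite /bump; lia.
ring.
Qed.

Lemma sum_merge a b y g M : (a < b)%N -> (b <= M)%N ->
  \sum_(0 <= j < M) merge a b y g j =
  \sum_(0 <= j < M.+1) g j - g a - g b + y.
Proof.
move=> ab; elim: M => [|M IHM]; first by rewrite leqn0 => /eqP b0; rewrite b0 in ab.
rewrite leq_eqVlt => /orP[/eqP bM|bM].
  by rewrite -bM sum_merge_mid // [in RHS]big_nat_recr //=; ring.
rewrite big_nat_recr //= IHM; last by lia.
rewrite [in RHS]big_nat_recr //= /merge ifF; last by lia.
have -> : bump b M = M.+1 by rewrite /bump; lia.
ring.
Qed.

Lemma sum_rot_front p g n : (p < n)%N ->
  \sum_(0 <= j < n) g (rot_front p j) = \sum_(0 <= j < n) g j.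
Proof.
elim: n => // n IHn; rewrite ltnS leq_eqVlt => /orP[/eqP <-|pn]; last first.
  rewrite !big_nat_recr //= IHn //; congr (_ + g _).
  by rewrite /rot_front ltnNge (ltnW pn) /= gtn_eqF.
rewrite big_nat_recr // [in RHS]big_nat_recl // addrC /rot_front ltnn eqxx; congr (_ + _).
by rewrite !big_nat; apply: eq_bigr => i /andP[_ ip]; rewrite ip.
Qed.

Lemma sum_rot_front_small p g n : (n <= p)%N ->
  \sum_(0 <= j < n) g (rot_front p j) = \sum_(0 <= j < n.+1) g j - g 0.
Proof.
move=> np; rewrite [in RHS]big_nat_recl // addrAC subrr add0r.
by rewrite !big_nat; apply: eq_bigr => i /andP[_ ip]; rewrite /rot_front ifT //; lia.
Qed.

End Sums.

(** * Rotations of a diagonal form *)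

Section Frames.
Context {R : realType}.
Variables (s xi : nat -> R).
Implicit Types (g eta : nat -> R) (U F : nat -> nat -> R).

(* The rows U i, i < k, are already chosen and the rows F j span what remains:
   together they have orthonormal columns, the compression of diag s to the F j
   is diagonal with entries eta j, and U i has the required value xi i. All sums
   are finite because rows and columns are finitely supported. *)
Definition frame k U F eta :=
  [/\ forall p q, ultimately (fun M =>
        \sum_(0 <= i < k) U i p * U i q + \sum_(0 <= j < M) F j p * F j q
        = (p == q)%:R),
      forall i j, ultimately (fun M =>
        \sum_(0 <= q < M) s q * (F i q * F j q) = (i == j)%:R * eta i) &
      forall i, (i < k)%N -> ultimately (fun M =>
        \sum_(0 <= q < M) s q * (U i q * U i q) = xi i)].

(** Quantified over all frames with values [eta], so that the choice of rotations becomes a question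
    about numbers only; rows once chosen are never revised. *)
Definition reach k eta k' eta' :=
  (k <= k')%N /\
  forall U F, frame k U F eta -> exists U' F',
    frame k' U' F' eta' /\ forall i, (i < k)%N -> U' i = U i.

Lemma reach_refl k eta : reach k eta k eta.
Proof. by split=> // U F fr; exists U, F. Qed.

Lemma reach_trans k1 eta1 k2 eta2 k3 eta3 :
  reach k1 eta1 k2 eta2 -> reach k2 eta2 k3 eta3 -> reach k1 eta1 k3 eta3.
Proof.
move=> [k12 H1] [k23 H2]; split; first exact: leq_trans k23.
move=> U F /H1[U2 [F2 [/H2[U3 [F3 [fr3 e3]]] e2]]].
exists U3, F3; split=> // i ik; rewrite e3 ?e2 //; exact: leq_trans k12.
Qed.

Lemma frame_sum_fin U k p q (u : nat -> R) :
  \sum_(0 <= i < k) (if i == k then u else U i) p * (if i == k then u else U i) q =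
  \sum_(0 <= i < k) U i p * U i q.
Proof. by rewrite !big_nat; apply: eq_bigr => i /andP[_ ik]; rewrite ltn_eqF. Qed.

Lemma reach_zero k eta : xi k = 0 -> reach k eta k.+1 eta.
Proof.
move=> xk0; split=> // U F [frC frA frU].
exists (fun i => if i == k then (fun=> 0) else U i), F; split; last first.
  by move=> i ik; rewrite ltn_eqF.
split=> //.
- move=> p q; apply: ultimately_mono (frC p q) => M.
  by rewrite big_nat_recr //= frame_sum_fin eqxx mulr0 addr0.
- move=> i; rewrite ltnS leq_eqVlt => /orP[/eqP ->|ik].
    by exists 0 => M _; rewrite eqxx big1 // => q _; rewrite !mulr0.
  by rewrite ltn_eqF //; exact: frU.
Qed.

Lemma reach_rot_front p k eta : reach k eta k (eta \o rot_front p).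
Proof.
split=> // U F [frC frA frU]; exists U, (F \o rot_front p); split=> //; split=> //.
- move=> a b; apply: ultimately_mono (ultimately_and (frC a b) (ultimately_ge p.+1)) => M [<- pM] /=.
  by rewrite (sum_rot_front (fun j => F j a * F j b)).
- move=> i j /=; apply: ultimately_mono (frA (rot_front p i) (rot_front p j)) => M ->.
  have -> // : (rot_front p i == rot_front p j) = (i == j).
  apply/eqP/eqP => [|-> //]; rewrite /rot_front.
  by case: (ltnP i p); case: (ltnP j p); case: (eqVneq i p); case: (eqVneq j p); lia.
Qed.

(** The new row is [u = c F_a + d F_b], and [r = d F_a - c F_b] replaces the pair. The trace of the
    2x2 block is invariant, which gives the value at [r]. Since [u] leaves the family F, diagonality
    concerns only [r] and the untouched vectors, to which both [F_a] and [F_b] were already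
    orthogonal for the form. *)
Lemma reach_merge k eta a b :
  (a < b)%N -> eta b <= xi k <= eta a ->
  reach k eta k.+1 (merge a b (eta a + eta b - xi k) eta).
Proof.
move=> ab /andP[bx xa].
have [c [d [cd1 cdx]]] : exists c d : R,
    c * c + d * d = 1 /\ c * c * eta a + d * d * eta b = xi k.
  (* The squares of [c] and [d] are the weights that write [xi k] as a convex combination of [eta a]
     and [eta b]. *)
  have [eab|nab] := eqVneq (eta a) (eta b).
    exists 1, 0; rewrite !mulr0 !mul1r mul0r !addr0; split=> //.
    by apply/eqP; rewrite eq_le xa eab bx.
  have dpos : 0 < eta a - eta b by rewrite subr_gt0 lt_neqAle eq_sym nab (le_trans bx).
  pose t := (xi k - eta b) / (eta a - eta b).
  have t0 : 0 <= t by rewrite divr_ge0 ?subr_ge0 // (le_trans bx).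
  have t1 : t <= 1 by rewrite ler_pdivrMr // mul1r lerD2r.
  exists (Num.sqrt t), (Num.sqrt (1 - t)).
  rewrite -!expr2 !sqr_sqrtr ?subr_ge0 //; split; first by ring.
  by rewrite /t; field; rewrite gt_eqF.
split=> // U F [frC frA frU].
pose u q := c * F a q + d * F b q.
pose r q := d * F a q - c * F b q.
exists (fun i => if i == k then u else U i), (merge a b r F); split; last first.
  by move=> i ik; rewrite ltn_eqF.
have nab : (a == b) = false by lia.
have nba : (b == a) = false by lia.
split=> //.
- move=> p q; have [N HN] := frC p q.
  exists (maxn N b) => M; rewrite geq_max => /andP[NM bM].
  (* Merging shortens the family by one: [M] new vectors correspond to [M.+1] old ones. *)
  rewrite big_nat_recr //= frame_sum_fin eqxx -(HN M.+1); last by lia.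
  rewrite -[RHS]addr0 -!addrA; congr (_ + _); rewrite addr0.
  transitivity (u p * u q + \sum_(0 <= j < M) merge a b (r p * r q) (fun j => F j p * F j q) j).
    congr (_ + _); apply: eq_bigr => j _; rewrite /merge; by case: ifP.
  rewrite sum_merge // /u /r.
  have -> : F a p * F a q = (c * c + d * d) * (F a p * F a q) by rewrite cd1 mul1r.
  have -> : F b p * F b q = (c * c + d * d) * (F b p * F b q) by rewrite cd1 mul1r.
  ring.
- have rj j : j != a -> j != b ->
      ultimately (fun M => \sum_(0 <= q < M) s q * (r q * F j q) = 0).
    move=> ja jb; apply: ultimately_mono (ultimately_and (frA a j) (frA b j)) => M [].
    rewrite [a == j]eq_sym [b == j]eq_sym (negbTE ja) (negbTE jb) !mul0r => h1 h2.
    transitivity (d * \sum_(0 <= q < M) s q * (F a q * F j q)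
       - c * \sum_(0 <= q < M) s q * (F b q * F j q)); last by rewrite h1 h2; ring.
    rewrite !mulr_sumr -sumrB; apply: eq_bigr => q _; rewrite /r; ring.
  have bumpa j : j != a -> bump b j != a by rewrite /bump; lia.
  have bumpb j : bump b j != b by rewrite /bump; lia.
  move=> i j; rewrite /merge; case: (eqVneq i a) => [ia|ia]; case: (eqVneq j a) => [ja|ja].
  all: rewrite ?ia ?ja.
  + rewrite eqxx mul1r.
    apply: ultimately_mono (ultimately_and (ultimately_and (frA a a) (frA b b)) (frA a b)) => M.
    rewrite !eqxx nab !mul1r mul0r => -[[haa hbb] hab].
    transitivity (d * d * \sum_(0 <= q < M) s q * (F a q * F a q)
       + c * c * \sum_(0 <= q < M) s q * (F b q * F b q)
       - 2 * c * d * \sum_(0 <= q < M) s q * (F a q * F b q)).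
      rewrite !mulr_sumr -big_split -sumrB; apply: eq_bigr => q _; rewrite /r /=; ring.
    rewrite haa hbb hab -cdx mulr0 subr0.
    have -> : eta a + eta b = (c * c + d * d) * (eta a + eta b) by rewrite cd1 mul1r.
    ring.
  + rewrite eq_sym (negbTE ja) mul0r; exact: rj (bumpa _ ja) (bumpb _).
  + rewrite (negbTE ia) mul0r.
    apply: ultimately_mono (rj _ (bumpa _ ia) (bumpb i)) => M h; rewrite -[RHS]h.
    by apply: eq_bigr => q _; rewrite [r q * _]mulrC.
  + apply: ultimately_mono (frA (bump b i) (bump b j)) => M ->.
    by congr (_%:R * _); rewrite /bump; lia.
- move=> i; rewrite ltnS leq_eqVlt => /orP[/eqP ->|ik]; last first.
    by rewrite ltn_eqF //; exact: frU.
  rewrite eqxx; apply: ultimately_mono (ultimately_and (ultimately_and (frA a a) (frA b b)) (frA a b)) => M.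
  rewrite !eqxx nab !mul1r mul0r => -[[haa hbb] hab].
  transitivity (c * c * \sum_(0 <= q < M) s q * (F a q * F a q)
       + d * d * \sum_(0 <= q < M) s q * (F b q * F b q)
       + 2 * c * d * \sum_(0 <= q < M) s q * (F a q * F b q)).
    rewrite !mulr_sumr -!big_split; apply: eq_bigr => q _; rewrite /u /=; ring.
  by rewrite haa hbb hab mulr0 addr0.
Qed.

Lemma frame_init : frame 0 (fun _ _ => 0) (fun j q => (j == q)%:R) s.
Proof.
have H (g : nat -> R) p q : ultimately (fun M =>
    \sum_(0 <= j < M) g j * ((j == p)%:R * (j == q)%:R) = (p == q)%:R * g p).
  exists p.+1 => M pM; rewrite (big_cat_nat (n := p)) //=; last by lia.
  rewrite big_nat big1; last by move=> i /andP[_ ip]; rewrite ltn_eqF // mul0r mulr0.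
  rewrite big_ltn // big_nat big1; last first.
    by move=> i /andP[ip _]; rewrite gtn_eqF // mul0r mulr0.
  by rewrite eqxx mul1r add0r addr0 mulrC.
split=> //.
- move=> p q; apply: ultimately_mono (H (fun=> 1) p q) => M.
  rewrite mulr1 => <-; rewrite big_geq // add0r.
  by apply: eq_bigr => j _; rewrite mul1r.
- move=> i j; apply: ultimately_mono (H s i j) => M <-.
  by apply: eq_bigr => q _; rewrite ![_ == q]eq_sym.
Qed.

Lemma frame_mass_le1 k U F eta p : frame k U F eta ->
  ultimately (fun M => \sum_(0 <= j < M) F j p * F j p <= 1).
Proof.
move=> [frC _ _]; apply: ultimately_mono (frC p p) => M; rewrite eqxx => h; have {h}<- : _ = 1 := h.
by rewrite lerDr sumr_ge0 // => i _; rewrite -expr2 sqr_ge0.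
Qed.

(* The residual mass D at p is the p-th entry of w = sum_j F_j(p) F_j, whose
   energy sum_q s_q w_q^2 is sum_j eta_j F_j(p)^2. *)
Lemma frame_mass_top k U F eta p B : (forall q, 0 <= s q) -> frame k U F eta ->
  (forall j, eta j <= B) -> 0 <= B ->
  ultimately (fun M => s p * (\sum_(0 <= j < M) F j p * F j p) ^+ 2 <= B).
Proof.
move=> s0 fr etaB B0; have [_ frA _] := fr.
apply: ultimately_mono (frame_mass_le1 p fr) => M D1.
set D := \sum_(0 <= j < M) _ in D1 *.
pose w q := \sum_(0 <= j < M) F j p * F j q.
(* Only the finitely many pairs below [M] occur, so one length [L] makes all their sums exact. *)
have [L [HL pL]] : exists L, (forall i, (i < M)%N -> forall j, (j < M)%N ->
    \sum_(0 <= q < L) s q * (F i q * F j q) = (i == j)%:R * eta i) /\ (p < L)%N.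
  apply: ultimately_ex; apply: ultimately_and (ultimately_ge p.+1).
  by apply: ultimately_all => i; apply: ultimately_all => j; exact: frA.
have E : \sum_(0 <= q < L) s q * w q ^+ 2 = \sum_(0 <= j < M) eta j * (F j p * F j p).
  transitivity (\sum_(0 <= q < L) \sum_(0 <= i < M) \sum_(0 <= j < M)
      F i p * F j p * (s q * (F i q * F j q))).
    apply: eq_bigr => q _; rewrite expr2 /w mulr_suml mulr_sumr.
    apply: eq_bigr => i _; rewrite !mulr_sumr; apply: eq_bigr => j _; ring.
  rewrite exchange_big /=; rewrite !big_nat; apply: eq_bigr => i /andP[_ iM].
  rewrite exchange_big /=.
  rewrite (big_cat_nat (n := i)) //=; last by lia.
  rewrite [X in _ + X]big_ltn //.
  have HH j : (j < M)%N -> \sum_(0 <= q < L) F i p * F j p * (s q * (F i q * F j q))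
      = F i p * F j p * ((i == j)%:R * eta i).
    by move=> jM; rewrite -mulr_sumr HL.
  rewrite big_nat big1; last first.
    by move=> j /andP[_ ji]; rewrite HH ?gtn_eqF ?mul0r ?mulr0 //; lia.
  rewrite HH // eqxx big_nat big1; last first.
    by move=> j /andP[ij jM]; rewrite HH // ltn_eqF // mul0r mulr0.
  by rewrite mul1r add0r addr0 mulrC.
apply: (@le_trans _ _ (\sum_(0 <= q < L) s q * w q ^+ 2)).
  rewrite (big_cat_nat (n := p)) //=; last by lia.
  rewrite [X in _ + X]big_ltn // addrCA lerDl addr_ge0 // sumr_ge0 // => q _;
  by rewrite mulr_ge0 // sqr_ge0.
rewrite E; apply: (@le_trans _ _ (\sum_(0 <= j < M) B * (F j p * F j p))).
  by apply: ler_sum => j _; rewrite ler_wpM2r // -expr2 sqr_ge0.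
by rewrite -mulr_sumr -[leRHS]mulr1 ler_wpM2l.
Qed.

End Frames.

Definition nonincr {R : realType} (f : nat -> R) :=
  forall m n, (m <= n)%N -> f n <= f m.

(** One-sided: on the nonnegative sequences considered here it is convergence to 0. *)
Definition to0 {R : realType} (f : nat -> R) :=
  forall eps : R, 0 < eps -> ultimately (fun n => f n < eps).

(** * The choice of the rotations *)

Section Greedy.
Context {R : realType}.
Variables (s xi : nat -> R).
Hypotheses (xi0 : forall n, 0 <= xi n) (xi_ni : nonincr xi) (xi_to0 : to0 xi).
Implicit Types (eta : nat -> R) (c d B : R).

Local Notation reach := (reach s xi).

(** The slack of the majorization still to be realized: remaining eigenvalues against the targets
    from [k] on. *)
Definition gap k eta n :=
  \sum_(0 <= j < n) eta j - \sum_(0 <= j < n) xi (k + j).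

Definition good k eta :=
  [/\ nonincr eta, forall n, 0 <= eta n, to0 eta & forall n, 0 <= gap k eta n].

Lemma gapS k eta n : gap k eta n.+1 =
  \sum_(0 <= j < n.+1) eta j - xi k - \sum_(0 <= j < n) xi (k.+1 + j).
Proof.
rewrite /gap [X in _ - X]big_nat_recl // addn0 opprD addrA; congr (_ - _).
by apply: eq_bigr => j _; rewrite addSnnS.
Qed.

(** Merging the two neighbours of [xi k], at positions m and m+1, keeps the list sorted. Beyond m
    both sides lose [xi k], so the gap at n is the old gap at n+1. Up to m every eigenvalue is at
    least [xi k], so in the old gap all terms but the first are nonnegative, whence the alternative
    with [eta 0 - xi k]. The last clause transmits a vanishing gap. *)
Lemma greedy_step k eta : good k eta -> exists eta',
  [/\ good k.+1 eta', reach k eta k.+1 eta', forall n, eta' n <= eta n,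
    forall n, gap k.+1 eta' n <= gap k eta n.+1 \/ eta 0%N - xi k <= gap k eta n.+1
  & ultimately (fun n => gap k.+1 eta' n <= gap k eta n.+1)].
Proof.
move=> [ni eta0 eta_to0 maj]; have [xk0|xkN0] := eqVneq (xi k) 0.
  have xz j : xi (k + j) = 0.
    by apply/eqP; rewrite eq_le xi0 -xk0 xi_ni // leq_addr.
  have gE n : gap k.+1 eta n = \sum_(0 <= j < n) eta j.
    by rewrite /gap [X in _ - X]big1 ?subr0 // => j _; rewrite addSnnS xz.
  have gE' n : gap k eta n = \sum_(0 <= j < n) eta j.
    by rewrite /gap [X in _ - X]big1 ?subr0 // => j _; rewrite xz.
  have gle n : gap k.+1 eta n <= gap k eta n.+1.
    by rewrite gE gE' big_nat_recr //= lerDl.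
  exists eta; split=> //.
  - by split=> // n; rewrite gE sumr_ge0.
  - exact: reach_zero.
  - by left.
  - by exists 0%N.
have xk_gt0 : 0 < xi k by rewrite lt_neqAle eq_sym xkN0 xi0.
have exm : exists m, eta m.+1 < xi k by have /ultimately_shift/ultimately_ex := eta_to0 _ xk_gt0.
case: (ex_minnP exm) => m mlt mmin.
(* For m = 0 this is majorization at length 1, otherwise minimality of m. *)
have xm : xi k <= eta m.
  case: m mlt mmin => [|m] _ mmin.
    by have := maj 1%N; rewrite /gap !big_nat1 addn0 subr_ge0.
  by rewrite leNgt; apply/negP => /mmin; rewrite ltnn.
have xj j : (j <= m)%N -> xi k <= eta j by move=> jm; rewrite (le_trans xm) ?ni.
pose y := eta m + eta m.+1 - xi k.
have ym : y <= eta m by rewrite /y -addrA gerDl subr_le0 ltW.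
have my : eta m.+1 <= y by rewrite /y addrAC lerDr subr_ge0.
pose eta' := merge m m.+1 y eta.
have eta'E j : eta' j = if j == m then y else if (j < m)%N then eta j else eta j.+1.
  rewrite /eta' /merge; case: eqP => // jm; rewrite /bump.
  by case: (ltnP j m) => h; congr eta; lia.
have gapL n : (m < n)%N -> gap k.+1 eta' n = gap k eta n.+1.
  move=> mn; rewrite gapS /gap /eta' sum_merge // big_nat_recr //= /y; ring.
have gapG n : (n <= m)%N -> eta 0%N - xi k <= gap k eta n.+1.
  move=> nm; rewrite gapS big_nat_recl //=.
  suff : 0 <= \sum_(0 <= j < n) eta j.+1 - \sum_(0 <= j < n) xi (k.+1 + j) by lra.
  rewrite -sumrB big_nat sumr_ge0 // => j /andP[_ jn].
  rewrite subr_ge0; apply: le_trans (xj _ _); last by lia.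
  by apply: xi_ni; lia.
exists eta'; split.
- split.
  + move=> a b; elim: b => [|b IHb]; first by rewrite leqn0 => /eqP ->.
    rewrite leq_eqVlt => /orP[/eqP -> //|ab].
    apply: le_trans (IHb ab); rewrite !eta'E.
    case: (ltngtP b m) => bm.
    - case: (eqVneq b.+1 m) => [e|bm'].
        by apply: le_trans ym _; apply: ni; exact: ltnW.
      by rewrite ifT ?ni //; lia.
    - by rewrite ifF ?ifF ?ni //; lia.
    - rewrite bm ifF ?ifF; [|lia|lia].
      by apply: le_trans my; rewrite ni //; lia.
  + move=> n; rewrite eta'E; case: eqP => _; first exact: le_trans my.
    by case: ifP.
  + move=> e e0; apply: ultimately_mono (ultimately_and (ultimately_ge m.+1) (ultimately_shift (eta_to0 e e0))) => n.
    by move=> [mn h]; rewrite eta'E ifF ?ifF //; lia.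
  + move=> n; case: (leqP n m) => nm; last by rewrite gapL.
    rewrite /gap /eta' sum_merge_small // -sumrB big_nat sumr_ge0 // => j /andP[_ jn].
    rewrite subr_ge0; apply: le_trans (xj _ _); last by lia.
    by apply: xi_ni; lia.
- by apply: reach_merge => //; rewrite xm (ltW mlt).
- move=> n; rewrite eta'E; case: eqP => [->|_] //; case: ifP => // _.
  exact: ni.
- move=> n; case: (leqP n m) => nm; [right|left]; [exact: gapG | by rewrite gapL].
- by exists m.+1 => n mn; rewrite gapL.
Qed.

Definition vanishing_gap k eta :=
  forall d N, 0 < d -> exists2 n, (N <= n)%N & gap k eta n < d.

Definition unbounded_sums := forall C : R, exists n, C < \sum_(0 <= j < n) xi j.

(** The two cases of infinite and finite trace, in the form inherited by later stages: the first
    does not depend on the stage, the second survives because a greedy step eventually does not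
    enlarge the gap. *)
Definition fuel k eta := unbounded_sums \/ vanishing_gap k eta.

Lemma greedy_step_fuel k eta : good k eta -> fuel k eta -> exists eta',
  [/\ good k.+1 eta', fuel k.+1 eta', reach k eta k.+1 eta',
    forall n, eta' n <= eta n &
    forall n, gap k.+1 eta' n <= gap k eta n.+1 \/ eta 0%N - xi k <= gap k eta n.+1].
Proof.
move=> gd fl; have [eta' [gd' rc le alt [N HN]]] := greedy_step gd.
exists eta'; split=> //; case: fl => [?|Z]; [by left|right] => d N' d0.
have [[//|n] nN nd] := Z d (maxn N N').+1 d0.
exists n; first by lia.
by apply: le_lt_trans nd; apply: HN; lia.
Qed.

Lemma greedy_steps k eta k' : (k <= k')%N -> good k eta -> fuel k eta -> exists eta',
  [/\ good k' eta', fuel k' eta', reach k eta k' eta' & forall n, eta' n <= eta n].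
Proof.
elim: k' => [|k' IH].
  by rewrite leqn0 => /eqP -> gd fl; exists eta; split=> //; exact: reach_refl.
rewrite leq_eqVlt => /orP[/eqP <- gd fl|kk gd fl].
  by exists eta; split=> //; exact: reach_refl.
have [e1 [gd1 fl1 rc1 le1]] := IH kk gd fl.
have [e2 [gd2 fl2 rc2 le2 _]] := greedy_step_fuel gd1 fl1.
by exists e2; split=> //; [exact: reach_trans rc2 | move=> n; exact: le_trans (le1 n)].
Qed.

(* If the greedy steps never bring the top value near the current xi, then the
   gap was already bounded below, so that the top value can be spread out. *)
Lemma greedy_stall k eta d : good k eta -> fuel k eta ->
  (forall k' eta', good k' eta' -> fuel k' eta' -> reach k eta k' eta' ->
     (forall n, eta' n <= eta n) -> d <= eta' 0%N - xi k') ->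
  forall n, d <= gap k eta n.+1.
Proof.
move=> gd fl H n; elim: n k eta gd fl H => [|n IHn] k eta gd fl H.
  rewrite /gap !big_nat1 addn0; apply: H => //; exact: reach_refl.
have [e [gd' fl' rc le alt]] := greedy_step_fuel gd fl.
have [h|h] := alt n.+1.
  apply: le_trans h; apply: IHn => // k2 e2 gd2 fl2 rc2 le2; apply: H => //.
    exact: reach_trans rc2.
  by move=> m; exact: le_trans (le m).
by apply: le_trans h; apply: H => //; exact: reach_refl.
Qed.

(** Entry 0 is exempt because spreading may lower it below its successors. *)
Definition tail_ni (eta : nat -> R) := nonincr (fun n => eta n.+1).

(* Rotating the top eigenvector with a far away one: the condition on the gap
   makes the deletion of the far entry harmless for majorization. *)
Lemma spread_step k eta c : (forall n, 0 <= eta n) -> tail_ni eta -> to0 eta ->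
  (forall n, c <= gap k eta n.+1) -> 0 < xi k <= c ->
  exists eta', [/\ reach k eta k.+1 eta', forall n, 0 <= eta' n,
    tail_ni eta', to0 eta' & [/\ forall n, c - xi k <= gap k.+1 eta' n.+1,
      eta' 0%N <= eta 0%N - xi k / 2 & forall n, eta' n.+1 <= eta n.+1]].
Proof.
move=> eta0 ni eta_to0 Hc /andP[xk0 xkc].
(* With [eta b] below [xi k / 2], the value left at the top is at most [eta 0 - xi k / 2]. *)
have [b [bx b1]] : exists b, eta b < xi k / 2 /\ (1 <= b)%N.
  by apply: ultimately_ex; apply: ultimately_and (ultimately_ge 1); apply: eta_to0; rewrite divr_gt0.
have x0 : c + xi k <= eta 0%N by have := Hc 0%N; rewrite /gap !big_nat1 addn0; lra.
have eta_b := eta0 b.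
pose y := eta 0%N + eta b - xi k.
pose eta' := merge 0 b y eta.
have eta'0 : eta' 0%N = y by [].
have eta'S j : eta' j.+1 = eta (bump b j.+1) by [].
exists eta'; split=> //.
- by apply: reach_merge => //; apply/andP; split; lra.
- by case=> [|n]; [rewrite eta'0 /y; lra | rewrite eta'S].
- move=> a b' ab; rewrite !eta'S /bump.
  by rewrite addnS addnS; apply: ni; lia.
- move=> e e0; have [N HN] := eta_to0 e e0; exists N.+1 => -[//|n] nN.
  by rewrite eta'S; apply: HN; rewrite /bump; lia.
split.
- move=> n; case: (leqP n.+1 b) => nb.
    rewrite /gap /eta' sum_merge_mid // /y [\sum_(0 <= j < n.+1) xi _]big_nat_recr //=.
    have := Hc n; rewrite gapS.
    have : xi (k.+1 + n) <= xi k by apply: xi_ni; lia.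
    lra.
  have := Hc n.+1; rewrite gapS /gap /eta' (sum_merge _ _ _ (ltnW nb)) // /y; lra.
- by rewrite eta'0 /y; lra.
- move=> n; rewrite eta'S /bump addnS; apply: ni; lia.
Qed.

(** The lower bound [c] on the gaps is a budget: the row with target [xi (k + i)] spends that amount
    and lowers the top by at least half of it. *)
Lemma spread r k eta c : (forall n, 0 <= eta n) -> tail_ni eta -> to0 eta ->
  (forall n, c <= gap k eta n.+1) -> (forall n, 0 < xi n) ->
  \sum_(0 <= i < r) xi (k + i) <= c ->
  exists eta', [/\ reach k eta (k + r) eta', forall n, 0 <= eta' n,
    tail_ni eta', to0 eta' & [/\
      forall n, c - \sum_(0 <= i < r) xi (k + i) <= gap (k + r) eta' n.+1,
      eta' 0%N <= eta 0%N - (\sum_(0 <= i < r) xi (k + i)) / 2 &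
      forall n, eta' n.+1 <= eta n.+1]].
Proof.
move=> eta0 ni eta_to0 Hc xip; elim: r => [|r IHr].
  rewrite big_geq // subr0 mul0r subr0 addn0 => _.
  by exists eta; split=> //; exact: reach_refl.
rewrite big_nat_recr //= => hs; have xkr := xip (k + r)%N.
have /IHr[e1 [rc1 e10 ni1 to01 [Hc1 top1 le1]]] : \sum_(0 <= i < r) xi (k + i) <= c by lra.
have [|e2 [rc2 e20 ni2 to02 [Hc2 top2 le2]]] := spread_step e10 ni1 to01 Hc1.
  by apply/andP; split=> //; lra.
exists e2; rewrite addnS; split=> //; first exact: reach_trans rc2.
split; [move=> n; have := Hc2 n; lra | lra | move=> n; exact: le_trans (le1 n)].
Qed.

(** Entry 0 goes back to its place. The last clause is the progress made: once entry 0 is at most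
    [B], entry [N.+1] can slide to position [N], so that one entry fewer may exceed [B]. *)
Lemma resort k eta : (forall n, 0 <= eta n) -> tail_ni eta -> to0 eta ->
  (forall n, 0 <= gap k eta n) -> 0 < eta 0%N ->
  exists eta', [/\ good k eta', reach k eta k eta' &
    forall B N, eta 0%N <= B -> eta N.+1 <= B -> eta' N <= B].
Proof.
move=> eta0 ni eta_to0 Hg x0.
have exp : exists p, eta p.+1 < eta 0%N by have /ultimately_shift/ultimately_ex := eta_to0 _ x0.
case: (ex_minnP exp) => p plt pmin.
have pge j : (j < p)%N -> eta 0%N <= eta j.+1.
  by move=> jp; rewrite leNgt; apply/negP => /pmin; lia.
pose eta' j := eta (rot_front p j).
have eta'E j : eta' j = if (j < p)%N then eta j.+1 else if j == p then eta 0%N else eta j.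
  by rewrite /eta' /rot_front; case: ifP => //; case: ifP.
exists eta'; split.
- split.
  + move=> a b; elim: b => [|b IHb]; first by rewrite leqn0 => /eqP ->.
    rewrite leq_eqVlt => /orP[/eqP -> //|ab].
    apply: le_trans (IHb ab); rewrite !eta'E.
    case: (ltngtP b p) => bp.
    - case: (ltngtP b.+1 p) => bp' //; [exact: ni | exact: pge].
    - by rewrite ifF ?ifF //; [case: b bp {IHb ab} => // b _; apply: ni | lia | lia].
    - by rewrite bp ifF ?ifF; [exact: ltW | lia | lia].
  + by move=> n; exact: eta0.
  + move=> e e0; have [N HN] := eta_to0 e e0; exists (maxn N p.+1) => n.
    rewrite geq_max => /andP[Nn pn]; rewrite eta'E ifF ?ifF; [exact: HN|lia|lia].
  + move=> n; case: (leqP n p) => np; last first.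
      by have := Hg n; rewrite /gap -(sum_rot_front eta np).
    rewrite /gap /eta' sum_rot_front_small //.
    have := Hg n; rewrite /gap big_nat_recr //=.
    case: n np => [|n] np; first by rewrite !big_geq //; lra.
    have := pge n np; lra.
- exact: reach_rot_front.
- move=> B N hB hN; rewrite eta'E; case: ltnP => // pN; case: eqP => // Np.
  case: N hN pN Np => [|N] hN pN Np //; apply: le_trans hB.
  by apply: le_trans (ltW plt); apply: ni; lia.
Qed.

End Greedy.

(** * Contraction of the top eigenvalue *)

Section Run.
Context {R : realType}.
Variables (s xi : nat -> R).
Hypotheses (xi0 : forall n, 0 <= xi n) (xi_ni : nonincr xi) (xi_to0 : to0 xi).
Implicit Types (eta : nat -> R) (c d B : R).

Lemma unbounded_sums_gt0 n : unbounded_sums xi -> 0 < xi n.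
Proof.
move=> H; rewrite lt_neqAle xi0 andbT eq_sym; apply/eqP => xn0.
have [m] := H (\sum_(0 <= j < n) xi j); apply/negP; rewrite -leNgt.
have [mn|nm] := leqP m n.
  rewrite [leRHS](big_cat_nat (n := m)) //= lerDl; exact: sumr_ge0.
rewrite [leLHS](big_cat_nat (n := n)) //=; last exact: ltnW.
rewrite [X in _ + X]big_nat [X in _ + X]big1 ?addr0 // => j /andP[nj _].
by apply/eqP; rewrite eq_le xi0 -xn0 xi_ni.
Qed.

(** Stopping just before the block sum exceeds [c] leaves less than one term of the budget
    unspent. *)
Lemma unbounded_sums_split k c : unbounded_sums xi -> 0 <= c -> exists r,
  \sum_(0 <= i < r) xi (k + i) <= c < \sum_(0 <= i < r) xi (k + i) + xi (k + r).
Proof.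
move=> H c0.
have ex : exists r, c < \sum_(0 <= i < r) xi (k + i).
  have [n hn] := H (c + \sum_(0 <= j < k) xi j); exists n.
  have : \sum_(0 <= j < n) xi j <= \sum_(0 <= j < k + n) xi j.
    by rewrite [leRHS](big_cat_nat (n := n)) ?leq_addl //= lerDl sumr_ge0.
  rewrite [leRHS](big_cat_nat (n := k)) ?leq_addr //=.
  have -> : \sum_(k <= i < k + n) xi i = \sum_(0 <= i < n) xi (k + i).
    by rewrite -{1}[k]add0n big_addn addKn; apply: eq_bigr => i _; rewrite addnC.
  lra.
case: (ex_minnP ex) => -[|r] hr rmin; first by rewrite big_geq // ltNge c0 in hr.
exists r; rewrite -big_nat_recr //= hr andbT leNgt.
by apply/negP => /rmin; rewrite ltnn.
Qed.

(** Induction on [N], which bounds the number of eigenvalues above [15 / 16 * x]. The bound [x]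
    stays fixed so that the threshold does not move while the eigenvalues are lowered one after the
    other. *)
Lemma top_contract_count N k eta x : good xi k eta -> fuel xi k eta -> 0 < x ->
  eta 0%N <= x -> eta N <= 15 / 16 * x -> exists k' eta',
  [/\ good xi k' eta', fuel xi k' eta', reach s xi k eta k' eta' &
      eta' 0%N <= 15 / 16 * x].
Proof.
elim: N k eta => [|N IHN] k eta gd fl x0 top hN.
  by exists k, eta; split=> //; exact: reach_refl.
(* This is 1/16 of the threshold: as long as the top exceeds [15 / 16 * x], all targets from [K] on
   are below 1/16 of the top. *)
have [K HK] := @xi_to0 (15 / 256 * x) ltac:(lra).
have [e1 [gd1 fl1 rc1 le1]] := greedy_steps s xi0 xi_ni (leq_maxl k K) gd fl.
set k1 := maxn k K in gd1 fl1 rc1.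
have xi_small n : (k1 <= n)%N -> xi n < 15 / 256 * x.
  by move=> kn; apply: HK; apply: leq_trans kn; rewrite leq_maxr.
have top1 := le1 0%N; have tail1 := le1 N.+1.
have [small|big1] := lerP (e1 0%N) (15 / 16 * x); first by exists k1, e1.
(* Either a greedy run brings the top within a quarter of its value of the current target, hence far
   below the threshold, or all gaps are at least that quarter. *)
have [[k' [e [gd' fl' rc' he]]]|stall] := pselect (exists k' eta',
    [/\ good xi k' eta', fuel xi k' eta', reach s xi k1 e1 k' eta' &
        eta' 0%N - xi k' < e1 0%N / 4]).
  exists k', e; split=> //; first exact: reach_trans rc'.
  by have := xi_small k' rc'.1; lra.
have gap1 : forall n, e1 0%N / 4 <= gap xi k1 e1 n.+1.
  apply: (greedy_stall (s := s)) => // k' e' gd' fl' rc' _; rewrite leNgt.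
  by apply/negP => he; apply: stall; exists k', e'.
have [unb|van] := fl1; last first.
  have [|[//|n] _] := van (e1 0%N / 4) 1%N; first by lra.
  by rewrite ltNge gap1.
(* The block sum lies between 3/16 and 4/16 of the top, so spreading leaves at most 29/32 of it. *)
have [|r /andP[Dle ltD]] := @unbounded_sums_split k1 (e1 0%N / 4) unb; first by lra.
have [ni1 e1_0 e1_to0 _] := gd1.
have xip n : 0 < xi n by exact: unbounded_sums_gt0.
have ni1S : tail_ni e1 by move=> a b ab; exact: ni1.
have [e2 [rc2 e2_0 ni2 e2_to0 [gap2 top2 tail2]]] := spread s xi_ni e1_0 ni1S e1_to0 gap1 xip Dle.
have := xi_small (k1 + r)%N (leq_addr _ _) => xsm.
have gap2' n : 0 <= gap xi (k1 + r) e2 n.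
  case: n => [|n]; first by rewrite /gap !big_geq // subrr.
  by have := gap2 n; lra.
have top2_gt0 : 0 < e2 0%N.
  by have := gap2' 1%N; have := xip (k1 + r)%N; rewrite /gap !big_nat1 addn0; lra.
have [e3 [gd3 rc3 b3]] := resort s e2_0 ni2 e2_to0 gap2' top2_gt0.
have := tail2 N => t2.
have he2 : e2 0%N <= 15 / 16 * x by lra.
have he2N : e2 N.+1 <= 15 / 16 * x by lra.
have top3 : e3 0%N <= x.
  by have := tail2 0%N; have := ni1 0%N 1%N isT => h1 h2; apply: b3; lra.
have fl3 : fuel xi (k1 + r) e3 by left.
(* By [b3], position [N] of the re-sorted list is below the threshold for the same [x]. *)
have [k4 [e4 [gd4 fl4 rc4 top4]]] := IHN _ e3 gd3 fl3 x0 top3 (b3 _ _ he2 he2N).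
exists k4, e4; split=> //.
exact: reach_trans (reach_trans (reach_trans rc1 rc2) rc3) rc4.
Qed.

(** One greedy step comes first to make the number of rows grow strictly: iteration has to exhaust
    all targets. *)
Lemma top_contract k eta : good xi k eta -> fuel xi k eta -> exists k' eta',
  [/\ good xi k' eta', fuel xi k' eta', (k < k')%N, reach s xi k eta k' eta' &
      eta' 0%N <= 15 / 16 * eta 0%N].
Proof.
move=> gd fl; have [_ eta_ge0 _ _] := gd.
have [e [gd1 fl1 rc1 le1]] := greedy_steps s xi0 xi_ni (leqnSn k) gd fl.
have [top0|topN0] := eqVneq (eta 0%N) 0.
  by exists k.+1, e; split=> //; have := le1 0%N; rewrite top0; lra.
have top_gt0 : 0 < eta 0%N by rewrite lt_neqAle eq_sym topN0 eta_ge0.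
have [N hN] : exists N, e N < 15 / 16 * eta 0%N.
  by have [_ _ e_to0 _] := gd1; apply: ultimately_ex; apply: e_to0; lra.
have [k' [e' [gd' fl' rc' top']]] := top_contract_count gd1 fl1 top_gt0 (le1 0%N) (ltW hN).
by exists k', e'; split=> //; [exact: rc'.1 | exact: reach_trans rc'].
Qed.

End Run.

(** * Passage to the limit: a matrix with orthonormal columns *)

Section Core.
Context {R : realType}.
Variables (s xi : nat -> R).
Hypotheses (s0 : forall n, 0 <= s n) (s_ni : nonincr s) (s_to0 : to0 s).
Hypotheses (xi0 : forall n, 0 <= xi n) (xi_ni : nonincr xi) (xi_to0 : to0 xi).
Hypothesis maj : forall n, \sum_(0 <= j < n) xi j <= \sum_(0 <= j < n) s j.
Hypothesis fl : fuel xi 0 s.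

Lemma frames_exist : exists (k : nat -> nat) (U F : nat -> nat -> nat -> R)
    (eta : nat -> nat -> R),
  [/\ forall t, frame s xi (k t) (U t) (F t) (eta t),
      forall t, (k t < k t.+1)%N,
      forall t i, (i < k t)%N -> U t.+1 i = U t i,
      forall t j, eta t j <= (15 / 16) ^+ t * s 0%N &
      forall t, 0 <= eta t 0%N].
Proof.
pose T := (nat * (nat -> nat -> R) * (nat -> nat -> R) * (nat -> R))%type.
pose inv (x : T) := let: (k, U, F, eta) := x in
  [/\ frame s xi k U F eta, good xi k eta & fuel xi k eta].
pose rel (x y : T) := let: (k, U, F, eta) := x in let: (k', U', F', eta') := y in
  [/\ (k < k')%N, forall i, (i < k)%N -> U' i = U i & eta' 0%N <= 15 / 16 * eta 0%N].
(* States violating the invariant are sent to themselves, so that the choice function is total. *)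
have step x : exists y, inv x -> inv y /\ rel x y.
  have [ix|nix] := pselect (inv x); last by exists x.
  case: x ix => [[[k U] F] eta] [fr gd fu].
  have [k' [eta' [gd' fu' kk rc top]]] := top_contract s xi0 xi_ni xi_to0 gd fu.
  have [U' [F' [fr' UU]]] := rc.2 U F fr.
  by exists (k', U', F', eta').
have [f Hf] := choice step.
pose x0 : T := (0%N, (fun _ _ => 0), (fun j q => (j == q)%:R), s).
have inv0 : inv x0.
  split=> //; first exact: frame_init.
  by split=> // n; rewrite /gap subr_ge0; exact: maj.
pose x t := iter t f x0.
have invx t : inv (x t) by elim: t => //= t /Hf[].
have relx t : rel (x t) (x t.+1) by case: (Hf _ (invx t)).
have E y : y = (y.1.1.1, y.1.1.2, y.1.2, y.2) :> T by case: y => [[[]]].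
have invx' t : [/\ frame s xi (x t).1.1.1 (x t).1.1.2 (x t).1.2 (x t).2,
    good xi (x t).1.1.1 (x t).2 & fuel xi (x t).1.1.1 (x t).2].
  by have := invx t; rewrite {1}[x t]E.
have relx' t : [/\ ((x t).1.1.1 < (x t.+1).1.1.1)%N,
    forall i, (i < (x t).1.1.1)%N -> (x t.+1).1.1.2 i = (x t).1.1.2 i &
    (x t.+1).2 0%N <= 15 / 16 * (x t).2 0%N].
  by have := relx t; rewrite {1}[x t]E {1}[x t.+1]E.
exists (fun t => (x t).1.1.1), (fun t => (x t).1.1.2), (fun t => (x t).1.2), (fun t => (x t).2).
split=> [t|t|t|t j|t].
- by case: (invx' t).
- by case: (relx' t).
- by case: (relx' t).
- have [_ [ni _ _ _] _] := invx' t.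
  apply: le_trans (ni 0%N j isT) _ => {j ni}.
  elim: t => [|t IHt]; first by rewrite expr0 mul1r.
  have [_ _ h] := relx' t; apply: le_trans h _.
  by rewrite exprS -[leRHS]mulrA ler_wpM2l //; lra.
- by have [_ [_ h _ _] _] := invx' t.
Qed.

(** At a stage where the missing mass in columns p and q is at most eps/2, the error of the finite
    Gram sum splits into the residual vectors and the later rows. Each part is at most eps/2 by the
    arithmetic-geometric inequality, since the later rows live on the same missing mass. *)
Theorem orthostochastic_realization : exists U : nat -> nat -> R,
  (forall i, ultimately (fun M => \sum_(0 <= q < M) s q * (U i q * U i q) = xi i)) /\
  (forall p q, 0 < s p -> 0 < s q -> forall eps : R, 0 < eps ->
    ultimately (fun n => `|(p == q)%:R - \sum_(0 <= i < n) U i p * U i q| <= eps)).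
Proof.
have [k [U [F [eta [fr kS UE eta_le eta_ge0]]]]] := frames_exist.
have k_ge t : (t <= k t)%N by elim: t => // t IH; apply: leq_ltn_trans IH (kS t).
have k_mono t t' : (t <= t')%N -> (k t <= k t')%N.
  elim: t' => [|t' IH]; first by rewrite leqn0 => /eqP ->.
  by rewrite leq_eqVlt => /orP[/eqP -> //|/IH h]; apply: leq_trans h (ltnW (kS _)).
have UE' t t' i : (t <= t')%N -> (i < k t)%N -> U t' i = U t i.
  elim: t' => [|t' IH]; first by rewrite leqn0 => /eqP ->.
  rewrite leq_eqVlt => /orP[/eqP -> //|tt] ik.
  rewrite ltnS in tt; rewrite UE; first exact: IH.
  exact: leq_trans ik (k_mono _ _ tt).
(* Rows are never revised and [k t >= t], so row [i] is final from stage [i.+1] on. *)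
pose V i := U i.+1 i.
have VE t i : (i < k t)%N -> V i = U t i.
  move=> ik; case: (leqP t i.+1) => h; first exact: UE'.
  by rewrite (@UE' i.+1 t i) //; first exact: ltnW.
have frV t : frame s xi (k t) V (F t) (eta t).
  have [frC frA frU] := fr t; split=> //.
    move=> p q; apply: ultimately_mono (frC p q) => M <-; congr (_ + _).
    by rewrite !big_nat; apply: eq_bigr => i /andP[_ ik]; rewrite (VE t).
  by move=> i ik; rewrite (VE t) //; exact: frU.
exists V; split=> [i|p q sp sq eps e0].
  by have [_ _] := frV i.+1; apply; exact: k_ge.
(* [frame_mass_top] bounds [s p'] times the squared mass by the top eigenvalue, which decays
   geometrically. *)
have mass p' : 0 < s p' -> ultimately (fun t => exists M0, forall M, (M0 <= M)%N ->
    \sum_(0 <= j < M) F t j p' * F t j p' <= eps / 2).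
  move=> sp'.
  have : ultimately (fun t => (15 / 16) ^+ t * s 0%N <= s p' * (eps / 2) ^+ 2).
    have s00 : 0 < s 0%N by apply: lt_le_trans sp' (s_ni _).
    have : ((15 / 16 : R) ^+ n @[n --> \oo] --> (0 : R))%classic.
      by apply: cvg_expr; rewrite ger0_norm; lra.
    move=> /cvgr0_norm_le/(_ (s p' * (eps / 2) ^+ 2 / s 0%N)).
    move=> /(_ _)[|N _ HN]; first by rewrite divr_gt0 // mulr_gt0 // exprn_gt0 // divr_gt0.
    exists N => t Nt; rewrite -ler_pdivlMr //; apply: le_trans (HN t Nt).
    exact: ler_norm.
  apply: ultimately_mono => t ht.
  have B0 : 0 <= s p' * (eps / 2) ^+ 2 by rewrite mulr_ge0 // sqr_ge0.
  have [M0 H] := frame_mass_top p' s0 (frV t) (fun j => le_trans (eta_le t j) ht) B0.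
  exists M0 => M /H; rewrite ler_pM2l // => h.
  rewrite -(@ler_pXn2r _ 2) // nnegrE; last by lra.
  by rewrite sumr_ge0 // => j _; rewrite -expr2 sqr_ge0.
have [t [[M1 H1] [M2 H2]]] := ultimately_ex (ultimately_and (mass p sp) (mass q sq)).
have [frC _ _] := frV t.
have amgm (a b : R) : `|a * b| <= (a * a + b * b) / 2.
  rewrite normrM; have := sqr_ge0 (`|a| - `|b|).
  have -> : a * a = `|a| * `|a| by rewrite -normrM ger0_norm // -expr2 sqr_ge0.
  have -> : b * b = `|b| * `|b| by rewrite -normrM ger0_norm // -expr2 sqr_ge0.
  by rewrite sqrrB !expr2; lra.
(* The total mass in a column is 1 at every stage; comparing stages [t] and [n] bounds the rows in
   between by the residual of stage [t]. *)
have tailV p' M0 : (forall M, (M0 <= M)%N -> \sum_(0 <= j < M) F t j p' * F t j p' <= eps / 2) ->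
    forall n, (k t <= n)%N -> \sum_(k t <= i < n) V i p' * V i p' <= eps / 2.
  move=> HM n kn.
  have [frCn _ _] := frV n.
  have [M [[hM hn] MM]] := ultimately_ex (ultimately_and (ultimately_and (frC p' p') (frCn p' p')) (ultimately_ge M0)).
  apply: le_trans (HM M MM).
  have : \sum_(0 <= i < n) V i p' * V i p' <= \sum_(0 <= i < k n) V i p' * V i p'.
    rewrite [leRHS](big_cat_nat (n := n)) //= lerDl sumr_ge0 // => i _.
    by rewrite -expr2 sqr_ge0.
  rewrite [leLHS](big_cat_nat (n := k t)) //=.
  have : 0 <= \sum_(0 <= j < M) F n j p' * F n j p'.
    by rewrite sumr_ge0 // => j _; rewrite -expr2 sqr_ge0.
  move: hM hn; rewrite eqxx => hM hn; lra.
exists (k t) => n kn.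
have [M [[hM M1M] M2M]] := ultimately_ex (ultimately_and (ultimately_and (frC p q) (ultimately_ge M1)) (ultimately_ge M2)).
rewrite -hM [X in _ - X](big_cat_nat (n := k t)) //= opprD addrACA subrr add0r.
apply: le_trans (ler_normB _ _) _.
have := tailV _ _ H1 n kn; have := tailV _ _ H2 n kn.
have := H1 M M1M; have := H2 M M2M => a1 a2 a3 a4.
have b1 : `|\sum_(0 <= j < M) F t j p * F t j q| <= eps / 2.
  apply: le_trans (ler_norm_sum _ _ _) _.
  apply: le_trans (ler_sum _ (fun j _ => amgm _ _)) _.
  by rewrite -mulr_suml big_split /=; lra.
have b2 : `|\sum_(k t <= i < n) V i p * V i q| <= eps / 2.
  apply: le_trans (ler_norm_sum _ _ _) _.
  apply: le_trans (ler_sum _ (fun j _ => amgm _ _)) _.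
  by rewrite -mulr_suml big_split /=; lra.
lra.
Qed.

End Core.

Local Open Scope classical_set_scope.

(** * Orthonormal systems in a Hilbert space *)

Section ComplexModulus.
Local Open Scope complex_scope.
Context {R : realType}.
Implicit Types z w : R[i].

(** Taken in [R] and not in [R[i]], since estimates use a total order; [sqnorm] below serves the
    same purpose. *)
Definition sqmod z : R := complex.Re z ^+ 2 + complex.Im z ^+ 2.

Lemma sqmodE z : (sqmod z)%:C = `|z| ^+ 2.
Proof. exact: add_Re2_Im2. Qed.

Lemma sqmod_mulconj z : (sqmod z)%:C = z * (Num.conj z).
Proof. by rewrite sqmodE normCK. Qed.

Lemma sqmod_ge0 z : 0 <= sqmod z.
Proof. by rewrite addr_ge0 // sqr_ge0. Qed.

Lemma sqmodM z w : sqmod (z * w) = sqmod z * sqmod w.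
Proof. by case: z => a b; case: w => c d; rewrite /sqmod /=; ring. Qed.

Lemma sqmod0 : sqmod 0 = 0 :> R.
Proof. by rewrite /sqmod /= expr0n addr0. Qed.

Lemma sqmod_real (r : R) : sqmod r%:C = r ^+ 2.
Proof. by rewrite /sqmod /= expr0n addr0. Qed.

Lemma sqmod_eq0 z : sqmod z = 0 -> z = 0.
Proof.
move=> /eqP; rewrite paddr_eq0 ?sqr_ge0 // !sqrf_eq0 => /andP[/eqP re0 /eqP im0].
by apply/eqP; rewrite eq_complex re0 im0 !eqxx.
Qed.

Lemma sqmod_conj z : sqmod (Num.conj z) = sqmod z.
Proof. by apply: (@complexI R); rewrite !sqmodE norm_conjC. Qed.

Lemma sqmod_Re z : complex.Re z ^+ 2 <= sqmod z.
Proof. by rewrite lerDl sqr_ge0. Qed.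

Lemma sqmodD z w : sqmod (z + w) <= 2 * sqmod z + 2 * sqmod w.
Proof.
case: z => a b; case: w => c d; rewrite /sqmod /=.
by have := sqr_ge0 (a - c); have := sqr_ge0 (b - d); rewrite !sqrrB !sqrrD; lra.
Qed.

Lemma ReM_real (r : R) z : complex.Re (r%:C * z) = r * complex.Re z.
Proof. by case: z => a b /=; rewrite mul0r subr0. Qed.

Lemma Re_sum I (l : seq I) (P : pred I) (F : I -> R[i]) :
  complex.Re (\sum_(i <- l | P i) F i) = \sum_(i <- l | P i) complex.Re (F i).
Proof.
by apply: (big_morph (@complex.Re R)) => // -[a b] [c d].
Qed.

End ComplexModulus.

Section HilbertBasics.
Local Open Scope complex_scope.
Context {R : realType} {H : completeNormedModType R[i]}.
Variable dot : {dot H for (@Num.conj R[i])}.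
Hypothesis hd : hilbert_dot dot.
Implicit Types (x y z : H) (a b : R[i]).

Lemma dotDl x y z : dot (x + y) z = dot x z + dot y z.
Proof. exact: (linearDl dot). Qed.
Lemma dotDr z x y : dot z (x + y) = dot z x + dot z y.
Proof. exact: (linearDr dot). Qed.
Lemma dotNl x z : dot (- x) z = - dot x z.
Proof. exact: (linearNl dot). Qed.
Lemma dotNr z x : dot z (- x) = - dot z x.
Proof. exact: (linearNr dot). Qed.
Lemma dot0l z : dot 0 z = 0.
Proof. exact: (linear0l dot). Qed.
Lemma dot0r z : dot z 0 = 0.
Proof. exact: (linear0r dot). Qed.
Lemma dotBl x y z : dot (x - y) z = dot x z - dot y z.
Proof. by rewrite dotDl dotNl. Qed.
Lemma dotBr z x y : dot z (x - y) = dot z x - dot z y.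
Proof. by rewrite dotDr dotNr. Qed.
Lemma dotZl a x z : dot (a *: x) z = a * dot x z.
Proof. exact: (linearZl_LR dot). Qed.
Lemma dotZr a z x : dot z (a *: x) = Num.conj a * dot z x.
Proof. exact: (linearZr_LR dot). Qed.
Lemma dotC x y : dot x y = Num.conj (dot y x).
Proof. by have := hermC dot x y; rewrite expr0 mul1r. Qed.
Lemma dot_suml I (l : seq I) (P : pred I) (F : I -> H) z :
  dot (\sum_(i <- l | P i) F i) z = \sum_(i <- l | P i) dot (F i) z.
Proof. exact: (linear_sumlz dot). Qed.
Lemma dot_sumr I (l : seq I) (P : pred I) (F : I -> H) z :
  dot z (\sum_(i <- l | P i) F i) = \sum_(i <- l | P i) dot z (F i).
Proof. exact: (linear_sumr dot). Qed.

Definition sqnorm x : R := complex.Re (dot x x).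
Local Notation n2 := sqnorm.

Lemma dotxx x : dot x x = (n2 x)%:C.
Proof.
have : 0 <= dot x x := dnorm_ge0 dot x.
by rewrite /sqnorm; case: (dot x x) => a b; rewrite lecE /= => /andP[/eqP -> _].
Qed.

Lemma sqnorm_ge0 x : 0 <= n2 x.
Proof. by rewrite -ler0c -dotxx; exact: dnorm_ge0. Qed.

Lemma sqnorm_eq0 x : n2 x = 0 -> x = 0.
Proof.
move=> h; apply/eqP; have := dnorm_eq0 dot x.
by rewrite dotxx h eqxx => <-.
Qed.

Lemma sqnorm0 : n2 0 = 0.
Proof. by rewrite /sqnorm dot0l. Qed.

Lemma sqnormD x y : n2 (x + y) = n2 x + n2 y + 2 * complex.Re (dot x y).
Proof.
rewrite /sqnorm dotDl !dotDr (dotC y x).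
case: (dot x x) => a b; case: (dot y y) => c d; case: (dot x y) => e f /=.
ring.
Qed.

Lemma sqnormZ a x : n2 (a *: x) = sqmod a * n2 x.
Proof.
apply: (@complexI R); rewrite -dotxx dotZl dotZr mulrA -sqmod_mulconj dotxx.
by rewrite -rmorphM.
Qed.

Lemma sqnormN x : n2 (- x) = n2 x.
Proof. by rewrite /sqnorm dotNl dotNr opprK. Qed.

Lemma sqnormB x y : n2 (x - y) = n2 x + n2 y - 2 * complex.Re (dot x y).
Proof. by rewrite sqnormD sqnormN dotNr raddfN /= mulrN. Qed.

Lemma sqnormBC x y : n2 (x - y) = n2 (y - x).
Proof. by rewrite -opprB sqnormN. Qed.

Lemma sqnormD_le x y : n2 (x + y) <= 2 * n2 x + 2 * n2 y.
Proof. by have := sqnorm_ge0 (x - y); rewrite sqnormB sqnormD; lra. Qed.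

Lemma sqnorm_tri x y z : n2 (x - z) <= 2 * n2 (x - y) + 2 * n2 (y - z).
Proof. by have := sqnormD_le (x - y) (y - z); rewrite addrA subrK. Qed.

Lemma cauchy_schwarz x y : sqmod (dot x y) <= n2 x * n2 y.
Proof.
have [y0|yN0] := eqVneq (n2 y) 0.
  by rewrite (sqnorm_eq0 y0) dot0r sqmod0 sqnorm0 mulr0.
have ypos : 0 < n2 y by rewrite lt_neqAle eq_sym yN0 sqnorm_ge0.
have := sqnorm_ge0 ((n2 y)%:C *: x - dot x y *: y).
rewrite sqnormB !sqnormZ sqmod_real dotZl dotZr.
rewrite [Num.conj _ * _]mulrC -sqmod_mulconj -rmorphM /=.
by rewrite expr2 -mulrA; nra.
Qed.

Lemma sqnorm_norm x : `|x| ^+ 2 = (n2 x)%:C.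
Proof. by rewrite hd dotxx. Qed.

Lemma norm_le_n2 x (r : R) : 0 <= r -> (`|x| <= r%:C) = (n2 x <= r ^+ 2).
Proof.
move=> r0; rewrite -(@ler_pXn2r _ 2) ?nnegrE ?ler0c //.
by rewrite sqnorm_norm -rmorphXn /= lecR.
Qed.

Lemma norm_lt_n2 x (r : R) : 0 <= r -> (`|x| < r%:C) = (n2 x < r ^+ 2).
Proof.
move=> r0; rewrite -(@ltr_pXn2r _ 2) ?nnegrE ?ler0c //.
by rewrite sqnorm_norm -rmorphXn /= ltcR.
Qed.

Lemma pos_complex (z : R[i]) : 0 < z -> exists2 r : R, 0 < r & z = r%:C.
Proof.
case: z => a b; rewrite ltcE /= => /andP[/eqP -> a0].
by exists a.
Qed.

Lemma sqnorm_cvgP (u : nat -> H) (l : H) :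
  (u @ \oo --> l) <-> (forall eps : R, 0 < eps -> ultimately (fun n => n2 (u n - l) < eps)).
Proof.
split=> [/cvgrPdist_lt h eps e0|h].
  have [//|N _ HN] := h (Num.sqrt eps)%:C; first by rewrite ltcR sqrtr_gt0.
  exists N => n Nn; have := HN n Nn.
  by rewrite norm_lt_n2 ?sqrtr_ge0 // sqr_sqrtr 1?ltW // sqnormBC.
apply/cvgrPdist_lt => _ /pos_complex[e e0 ->].
have [N HN] := h _ (exprn_gt0 2 e0); exists N => // n Nn.
by rewrite norm_lt_n2 1?ltW // sqnormBC; exact: HN.
Qed.

Lemma sqnorm_complete (u : nat -> H) :
  (forall eps : R, 0 < eps -> exists N, forall n m, (N <= n)%N -> (N <= m)%N ->
     n2 (u n - u m) < eps) ->
  exists l : H, u @ \oo --> l.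
Proof.
move=> h; suff h0 : cvgn u by exists (limn u).
apply/cauchy_cvgP/cauchy_exP => _ /pos_complex[e e0 ->].
have [N HN] := h _ (exprn_gt0 2 e0).
exists (u N), N => // n Nn; rewrite -ball_normE /ball_ /= norm_lt_n2 1?ltW //; exact: HN.
Qed.

Lemma bounded_opP (T : H -> H) : bounded_op T <->
  linear T /\ exists2 M : R, 0 <= M & forall x, n2 (T x) <= M * n2 x.
Proof.
split=> -[lT].
  move=> [M hM]; split=> //; exists (M ^+ 2); first exact: sqr_ge0.
  move=> x; have := hM x; have [M0|M0] := leP 0 M.
    move=> h; rewrite -lecR rmorphM /= rmorphXn /= -!sqnorm_norm -exprMn.
    by rewrite ler_pXn2r // nnegrE // mulr_ge0 // ler0c.
  (* A negative constant in the bound forces [T x = 0]. *)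
  move=> h; have Tx0 : `|T x| = 0.
    apply/eqP; rewrite eq_le normr_ge0 andbT (le_trans h) //.
    by rewrite mulr_le0_ge0 // (_ : 0 = 0%:C) // lecR ltW.
  have -> : n2 (T x) = 0 by apply: (@complexI R); rewrite -sqnorm_norm Tx0 expr0n.
  by rewrite mulr_ge0 ?sqr_ge0 ?sqnorm_ge0.
move=> [M M0 hM]; split=> //; exists (Num.sqrt M) => x.
rewrite -(@ler_pXn2r _ 2) ?nnegrE //; last by rewrite mulr_ge0 // ler0c sqrtr_ge0.
by rewrite exprMn !sqnorm_norm -rmorphXn /= sqr_sqrtr // -rmorphM lecR.
Qed.

Section LinearMap.
Local Open Scope complex_scope.
Variable T : H -> H.
Hypothesis lT : linear T.

Lemma linD x y : T (x + y) = T x + T y.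
Proof. by have := lT 1 x y; rewrite !scale1r. Qed.
Lemma lin0 : T 0 = 0.
Proof. by have := lT (-1) 0 0; rewrite scaler0 addr0 scaleN1r addNr. Qed.
Lemma linZ a x : T (a *: x) = a *: T x.
Proof. by have := lT a x 0; rewrite !addr0 lin0 addr0. Qed.
Lemma linN x : T (- x) = - T x.
Proof. by rewrite -scaleN1r linZ scaleN1r. Qed.
Lemma linB x y : T (x - y) = T x - T y.
Proof. by rewrite linD linN. Qed.
Lemma lin_sum I (l : seq I) (P : pred I) (F : I -> H) :
  T (\sum_(i <- l | P i) F i) = \sum_(i <- l | P i) T (F i).
Proof. by apply: big_morph; [exact: linD | exact: lin0]. Qed.
End LinearMap.

Lemma cvg_bounded_op T (u : nat -> H) (l : H) : bounded_op T ->
  u @ \oo --> l -> T \o u @ \oo --> T l.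
Proof.
move=> /bounded_opP[lT [M M0 hM]] /sqnorm_cvgP h; apply/sqnorm_cvgP => eps e0.
have M1 : 0 < M + 1 by lra.
have [N HN] := h _ (divr_gt0 e0 M1); exists N => n /HN.
rewrite ltr_pdivlMr // => h1 /=; rewrite -linB //.
by have := hM (u n - l); have := sqnorm_ge0 (u n - l); nra.
Qed.

Lemma cvg_dotl (u : nat -> H) (l y : H) : u @ \oo --> l ->
  forall eps : R, 0 < eps -> ultimately (fun n => sqmod (dot (u n) y - dot l y) < eps).
Proof.
move=> /sqnorm_cvgP h eps e0; have y1 : 0 < n2 y + 1 by have := sqnorm_ge0 y; lra.
have [N HN] := h _ (divr_gt0 e0 y1); exists N => n /HN.
rewrite ltr_pdivlMr // -dotBl => h1; apply: le_lt_trans (cauchy_schwarz _ _) _.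
by have := sqnorm_ge0 y; have := sqnorm_ge0 (u n - l); nra.
Qed.

Lemma sqnorm_lim_unique (u : nat -> H) (l l' : H) : u @ \oo --> l -> u @ \oo --> l' -> l = l'.
Proof. by move=> h1 h2; apply: cvg_unique h1 h2. Qed.

End HilbertBasics.

Lemma bounded_psum_cauchy {R : realType} (a : nat -> R) (B : R) :
  (forall k, 0 <= a k) -> (forall n, \sum_(0 <= k < n) a k <= B) ->
  forall eps : R, 0 < eps -> exists N, forall m n, (N <= m)%N -> (m <= n)%N ->
    \sum_(m <= k < n) a k < eps.
Proof.
move=> a0 hB eps e0.
have ni : nondecreasing_seq (fun n => \sum_(0 <= k < n) a k).
  move=> m n mn; rewrite [leRHS](big_cat_nat (n := m)) //= lerDl.
  exact: sumr_ge0.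
have ub : has_ubound (range (fun n => \sum_(0 <= k < n) a k)).
  by exists B => _ [n _ <-]; exact: hB.
have := nondecreasing_cvgn ni ub; set l := sup _ => h.
have /cvgrPdist_lt/(_ eps e0)[N _ HN] := h; exists N => m n Nm mn.
have lem k : \sum_(0 <= j < k) a j <= l.
  by have := nondecreasing_cvgn_le ni (cvgP _ h) k; rewrite (cvg_lim _ h).
have := HN m Nm; have := lem n.
rewrite (big_cat_nat (n := m)) //= => h1; have := lem m => h2.
by rewrite ger0_norm ?subr_ge0 //; lra.
Qed.

(** * Orthonormal systems with padding: Riesz-Fischer and Bessel *)

Section Systems.
Local Open Scope complex_scope.
Context {R : realType} {H : completeNormedModType R[i]}.
Variable dot : {dot H for (@Num.conj R[i])}.
Hypothesis hd : hilbert_dot dot.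
Implicit Types (x y z : H) (a b : R[i]) (c : nat -> R[i]) (f g e : nat -> H).

Local Notation n2 := (sqnorm dot).

Lemma sqnorm_cvg (u : nat -> H) (l : H) : u @ \oo --> l -> n2 \o u @ \oo --> n2 l.
Proof.
move=> /(sqnorm_cvgP hd) h; apply/cvgrPdist_le => eps e0.
have l0 := sqnorm_ge0 dot l; have l1 : 0 < n2 l + 1 by lra.
pose d := (eps / 4) ^+ 2 / (n2 l + 1).
have d0 : 0 < d by rewrite divr_gt0 // exprn_gt0 // divr_gt0.
have e2 : 0 < eps / 2 by lra.
have [N1 H1] := h _ d0; have [N2 H2] := h _ e2.
exists (maxn N1 N2) => // n /=; rewrite geq_max => /andP[/H1 h1 /H2 h2].
have -> : n2 l - n2 (u n) = - (n2 (u n - l) + 2 * complex.Re (dot l (u n - l))).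
  have {1}-> : u n = l + (u n - l) by rewrite addrC subrK.
  by rewrite sqnormD; ring.
rewrite normrN; set r := complex.Re _; set w := n2 (u n - l) in h1 h2 *.
have w0 : 0 <= w := sqnorm_ge0 dot _.
have rw : r ^+ 2 <= n2 l * w.
  exact: le_trans (sqmod_Re _) (cauchy_schwarz dot _ _).
have r2 : r ^+ 2 <= (eps / 4) ^+ 2.
  by move: h1; rewrite /d ltr_pdivlMr //; nra.
have : `|r| <= eps / 4.
  by rewrite -(@ler_pXn2r _ 2) ?nnegrE ?real_normK ?num_real //; lra.
by rewrite !ler_norml => /andP[? ?]; apply/andP; split; lra.
Qed.

Lemma sqmod_small0 (z : R[i]) : (forall eps : R, 0 < eps -> sqmod z < eps) -> z = 0.
Proof.
move=> h; apply: sqmod_eq0; apply/eqP; rewrite eq_le sqmod_ge0 andbT leNgt.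
by apply/negP => /h; rewrite ltxx.
Qed.

Lemma dot_lim_eq (u v : nat -> H) (l l' y z : H) :
  u @ \oo --> l -> v @ \oo --> l' ->
  ultimately (fun n => dot (u n) y = dot (v n) z) -> dot l y = dot l' z.
Proof.
move=> ul vl' huv; apply/eqP; rewrite -subr_eq0; apply/eqP/sqmod_small0 => eps e0.
have e4 : 0 < eps / 4 by lra.
have [n [[h1 h2] h3]] :=
  ultimately_ex (ultimately_and (ultimately_and (cvg_dotl hd y ul e4) (cvg_dotl hd z vl' e4)) huv).
have -> : dot l y - dot l' z =
    - (dot (u n) y - dot l y) + (dot (v n) z - dot l' z).
  by rewrite h3; ring.
apply: le_lt_trans (sqmodD _ _) _; have -> (w : R[i]) : sqmod (- w) = sqmod w.
  by rewrite -mulN1r sqmodM /sqmod /= oppr0 sqrrN expr1n expr0n addr0 mul1r.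
lra.
Qed.

Lemma dot_lim (u : nat -> H) (l y : H) a : u @ \oo --> l ->
  ultimately (fun n => dot (u n) y = a) -> dot l y = a.
Proof.
move=> ul ha; apply/eqP; rewrite -subr_eq0; apply/eqP/sqmod_small0 => eps e0.
have [n [h1 h2]] := ultimately_ex (ultimately_and (cvg_dotl hd y ul e0) ha).
rewrite -h2 -opprB -mulN1r sqmodM; suff -> : sqmod (-1 : R[i]) = 1 by rewrite mul1r.
by rewrite /sqmod /= oppr0 sqrrN expr1n expr0n addr0.
Qed.

(* Vectors with al i = false vanish: this pads finite orthonormal families. *)
Definition osys g (al : pred nat) :=
  forall i j, dot (g i) (g j) = ((i == j) && al i)%:R.

Definition psum c g n : H := \sum_(0 <= k < n) c k *: g k.

Definition sqsum c := exists B : R, forall n, \sum_(0 <= k < n) sqmod (c k) <= B.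

Definition hsum c g : H := limn (series (fun k => c k *: g k)).

Section OneSystem.
Local Open Scope complex_scope.
Variables (g : nat -> H) (al : pred nat).
Hypothesis og : osys g al.

Lemma dot_osum c m n j : (j < n)%N -> (m <= j)%N ->
  dot (\sum_(m <= k < n) c k *: g k) (g j) = c j * (al j)%:R.
Proof.
move=> jn mj; rewrite dot_suml (big_cat_nat (n := j)) //=; last exact: ltnW.
rewrite [X in _ + X]big_ltn // big_nat big1; last first.
  by move=> i /andP[_ ij]; rewrite dotZl og ltn_eqF //= mulr0.
rewrite big_nat big1; last first.
  by move=> i /andP[ij _]; rewrite dotZl og gtn_eqF //= mulr0.
by rewrite dotZl og eqxx add0r addr0.
Qed.

Lemma sqnorm_osum c m n :
  n2 (\sum_(m <= k < n) c k *: g k) = \sum_(m <= k < n) sqmod (c k) * (al k)%:R.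
Proof.
case: (leqP m n) => [mn|nm]; last by rewrite !big_geq ?sqnorm0 // ltnW.
rewrite /sqnorm; have -> : dot (\sum_(m <= k < n) c k *: g k) (\sum_(m <= k < n) c k *: g k)
    = \sum_(m <= j < n) (sqmod (c j) * (al j)%:R)%:C.
  rewrite dot_sumr [LHS]big_nat [RHS]big_nat; apply: eq_bigr => j /andP[mj jn].
  rewrite dotZr dot_osum // mulrA [Num.conj _ * _]mulrC -sqmod_mulconj rmorphM /=.
  by case: (al j); rewrite ?mulr1 ?mulr0.
by rewrite Re_sum; apply: eq_bigr.
Qed.

(** Riesz-Fischer: the squared norm of a block of the series is at most the corresponding block of
    the sum of [sqmod (c k)], so completeness applies. *)
Lemma psum_cvg c : sqsum c -> psum c g @ \oo --> hsum c g.
Proof.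
move=> [B hB].
have a0 k : 0 <= sqmod (c k) by exact: sqmod_ge0.
have [l hl] : exists l : H, psum c g @ \oo --> l.
  apply: (sqnorm_complete hd) => eps e0.
  have [N HN] := bounded_psum_cauchy a0 hB e0; exists N.
  have main n m : (N <= n)%N -> (n <= m)%N -> n2 (psum c g m - psum c g n) < eps.
    move=> Nn nm; rewrite /psum (big_cat_nat (n := n)) //= addrAC subrr add0r sqnorm_osum.
    apply: le_lt_trans (HN n m Nn nm); apply: ler_sum => k _.
    by case: (al k); rewrite ?mulr1 ?mulr0.
  move=> n m Nn Nm; case/orP: (leq_total n m) => h; last exact: main.
  by rewrite sqnormBC; exact: main.
have -> : hsum c g = l; last by [].
exact: (cvg_lim _ hl).
Qed.

Lemma dot_hsum c j : sqsum c -> dot (hsum c g) (g j) = c j * (al j)%:R.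
Proof.
move=> sc; apply: dot_lim (psum_cvg sc) _.
by exists j.+1 => n jn; exact: dot_osum.
Qed.

Lemma bessel_fin x n : \sum_(0 <= k < n) sqmod (dot x (g k)) <= n2 x.
Proof.
pose c k := dot x (g k); pose w := psum c g n.
have cal k : sqmod (c k) * (al k)%:R = sqmod (c k).
  case alk : (al k); rewrite ?mulr1 // mulr0.
  have /sqnorm_eq0 gk0 : n2 (g k) = 0 by rewrite /sqnorm og alk andbF.
  by rewrite /c gk0 dot0r sqmod0.
have dxw : dot x w = (\sum_(0 <= k < n) sqmod (c k))%:C.
  rewrite /w dot_sumr rmorph_sum; apply: eq_bigr => k _.
  by rewrite dotZr mulrC -sqmod_mulconj.
have n2w : n2 w = \sum_(0 <= k < n) sqmod (c k).
  by rewrite /w sqnorm_osum; apply: eq_bigr => k _.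
have := sqnorm_ge0 dot (x - w); rewrite sqnormB dxw n2w /=; lra.
Qed.

Lemma sqsum_dot x : sqsum (fun k => dot x (g k)).
Proof. by exists (n2 x) => n; exact: bessel_fin. Qed.

Definition oproj x := hsum (fun k => dot x (g k)) g.

Lemma oproj_cvg x : psum (fun k => dot x (g k)) g @ \oo --> oproj x.
Proof. exact: psum_cvg (sqsum_dot x). Qed.

Lemma dot_oproj x j : dot (oproj x) (g j) = dot x (g j).
Proof.
rewrite dot_hsum; last exact: sqsum_dot.
case alj : (al j); rewrite ?mulr1 // mulr0.
have /sqnorm_eq0 -> : n2 (g j) = 0 by rewrite /sqnorm og alj andbF.
by rewrite dot0r.
Qed.

Lemma oproj_perp x j : dot (x - oproj x) (g j) = 0.
Proof. by rewrite dotBl dot_oproj subrr. Qed.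

Lemma perp_hsum c y : sqsum c -> (forall j, dot y (g j) = 0) -> dot y (hsum c g) = 0.
Proof.
move=> sc h; rewrite dotC; suff -> : dot (hsum c g) y = 0 by rewrite rmorph0.
apply: dot_lim (psum_cvg sc) _; exists 0%N => n _.
by rewrite dot_suml big1 // => i _; rewrite dotZl dotC h rmorph0 mulr0.
Qed.

End OneSystem.
End Systems.

Arguments oproj_cvg {R H dot} hd {g al} og x.
Arguments psum_cvg {R H dot} hd {g al} og {c} sc.

Lemma xget_unique (X : choiceType) (x0 : X) (P : set X) (x : X) :
  P x -> (forall y, P y -> y = x) -> xget x0 P = x.
Proof. by move=> Px h; apply: h; exact: (xgetPex _ (ex_intro _ x Px)). Qed.

(** * Parseval and adjoints *)

Section Basis.
Local Open Scope complex_scope.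
Context {R : realType} {H : completeNormedModType R[i]}.
Variable dot : {dot H for (@Num.conj R[i])}.
Hypothesis hd : hilbert_dot dot.
Variable e : nat -> H.
Hypothesis he : orthonormal_basis dot e.
Implicit Types (x y z : H) (T S : H -> H).

Local Notation n2 := (sqnorm dot).
Local Notation coef x := (fun k => dot x (e k)).

Lemma basis_osys : osys dot e predT.
Proof. by move=> i j; rewrite he.1 andbT. Qed.

Lemma basis_psum_cvg x : psum (coef x) e @ \oo --> x.
Proof. exact: he.2. Qed.

Arguments basis_psum_cvg x : clear implicits.

Lemma basis_oproj x : oproj dot e x = x.
Proof. exact: sqnorm_lim_unique (oproj_cvg hd basis_osys x) (basis_psum_cvg x). Qed.

Lemma basis_eq x y : (forall k, dot x (e k) = dot y (e k)) -> x = y.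
Proof.
move=> h; rewrite -(basis_oproj x) -(basis_oproj y) /oproj.
by congr hsum; apply/funext => k.
Qed.

Lemma sqnorm_basis k : n2 (e k) = 1.
Proof. by rewrite /sqnorm he.1 eqxx. Qed.

Lemma parseval x : (fun n => \sum_(0 <= k < n) sqmod (dot x (e k))) @ \oo --> n2 x.
Proof.
have := sqnorm_cvg hd (basis_psum_cvg x).
rewrite (_ : _ \o _ = fun n => \sum_(0 <= k < n) sqmod (dot x (e k))) //.
apply/funext => n /=; rewrite /psum (sqnorm_osum basis_osys).
by apply: eq_bigr => k _; rewrite mulr1.
Qed.

Lemma sqnorm_le_lim (u : nat -> H) (l : H) (B : R) : u @ \oo --> l ->
  (forall n, n2 (u n) <= B) -> n2 l <= B.
Proof.
move=> ul h; apply: (cvgr_to_le (sqnorm_cvg hd ul)).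
by apply: nearW => n /=; exact: h.
Qed.

Definition is_adjoint T S := bounded_op S /\ forall x y, dot (T x) y = dot x (S y).

(** The coefficients of [S y] must be [dot y (T (e k))]. They are square summable: if w is their
    truncated series, with squared norm t, then t equals [dot y (T w)], so t^2 <= n2 y * M * t by
    Cauchy-Schwarz. *)
Lemma adjoint_exists T : bounded_op T -> exists S, is_adjoint T S.
Proof.
move=> bT; have [lT [M M0 hM]] := (bounded_opP hd T).1 bT.
pose c y k := dot y (T (e k)).
have key y n : \sum_(0 <= k < n) sqmod (c y k) <= M * n2 y.
  set t := \sum_(0 <= k < n) _.
  have t0 : 0 <= t by apply: sumr_ge0 => k _; exact: sqmod_ge0.
  pose w := psum (c y) e n.
  have n2w : n2 w = t.
    by rewrite /w /psum (sqnorm_osum basis_osys); apply: eq_bigr => k _; rewrite mulr1.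
  have dyw : dot y (T w) = t%:C.
    rewrite /w /psum lin_sum // dot_sumr /t rmorph_sum; apply: eq_bigr => k _ /=.
    by rewrite linZ // dotZr mulrC -sqmod_mulconj.
  have := cauchy_schwarz dot y (T w); rewrite dyw sqmod_real.
  have := hM w; rewrite n2w => h1 h2.
  have [->|tN0] := eqVneq t 0; first by rewrite mulr_ge0 // sqnorm_ge0.
  have tp : 0 < t by rewrite lt_neqAle eq_sym tN0.
  have : t * t <= t * (M * n2 y) by have := sqnorm_ge0 dot y; rewrite -expr2; nra.
  by rewrite ler_pM2l.
have sc y : sqsum (c y) by exists (M * n2 y); exact: key.
pose S y := hsum (c y) e.
have dS y k : dot (S y) (e k) = c y k.
  by rewrite /S (dot_hsum hd basis_osys) // mulr1.
exists S; split.
  apply/(bounded_opP hd); split.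
    move=> a x y; apply: basis_eq => k.
    by rewrite dotDl dotZl !dS /c dotDl dotZl.
  exists M => // y; apply: sqnorm_le_lim (psum_cvg hd basis_osys (sc y)) _ => n.
  rewrite /psum (sqnorm_osum basis_osys); apply: le_trans (key y n).
  by apply: ler_sum => k _; rewrite mulr1.
move=> x y; apply: (dot_lim_eq hd (u := T \o psum (coef x) e) (v := psum (coef x) e)).
- by apply: cvg_bounded_op => //; exact: basis_psum_cvg.
- exact: basis_psum_cvg.
exists 0%N => n _ /=; rewrite /psum lin_sum // !dot_suml; apply: eq_bigr => k _.
by rewrite linZ // !dotZl (dotC dot (T _)) (dotC dot (e k) (S y)) dS.
Qed.

Lemma adjointP T : bounded_op T -> is_adjoint T (adjoint dot T).
Proof.
move=> /adjoint_exists[S hS]; rewrite /adjoint.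
have := @xgetPex _ (fun=> 0) [set S | bounded_op S /\ forall x y, dot (T x) y = dot x (S y)].
by apply; exists S.
Qed.

Lemma dot_ext x y : (forall z, dot z x = dot z y) -> x = y.
Proof.
move=> h; apply/eqP; rewrite -subr_eq0; apply/eqP/(@sqnorm_eq0 _ _ dot).
by rewrite /sqnorm dotBr h subrr.
Qed.

Lemma adjoint_unique T S : bounded_op T ->
  bounded_op S -> (forall x y, dot (T x) y = dot x (S y)) -> adjoint dot T = S.
Proof.
move=> bT bS h; apply/funext => y; apply: dot_ext => x.
by rewrite -(adjointP bT).2 h.
Qed.

End Basis.

(** * Positive operators and their quadratic forms *)

Section Positive.
Local Open Scope complex_scope.
Context {R : realType} {H : completeNormedModType R[i]}.
Variable dot : {dot H for (@Num.conj R[i])}.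
Hypothesis hd : hilbert_dot dot.
Implicit Types (x y z : H).
Local Notation n2 := (sqnorm dot).

Variable T : H -> H.
Hypothesis pT : positive_op dot T.

Definition qform x : R := complex.Re (dot (T x) x).
Local Notation qf := qform.

Lemma pos_lin : linear T.
Proof. by have [/(bounded_opP hd)[]] := pT. Qed.

Lemma qfE x : dot (T x) x = (qf x)%:C.
Proof.
have [_ /(_ x)] := pT; rewrite /qform; case: (dot (T x) x) => a b.
by rewrite lecE /= => /andP[/eqP -> _].
Qed.

Lemma qf_ge0 x : 0 <= qf x.
Proof. by have [_ /(_ x)] := pT; rewrite qfE ler0c. Qed.

(** Polarization: the form is real at [x + y] and at [x + 'i *: y], which settles the imaginary and
    the real part. *)
Lemma pos_sym x y : dot (T y) x = Num.conj (dot (T x) y).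
Proof.
have lT := pos_lin.
have : complex.Im (dot (T (x + y)) (x + y)) = 0 by rewrite qfE.
rewrite linD // !(dotDl, dotDr) !qfE.
have : complex.Im (dot (T (x + 'i *: y)) (x + 'i *: y)) = 0 by rewrite qfE.
rewrite linD // linZ // !(dotDl, dotDr, dotZl, dotZr) !qfE.
case: (dot (T x) y) => a b; case: (dot (T y) x) => c d /= h1 h2.
by apply/eqP; rewrite eq_complex /=; apply/andP; split; apply/eqP; lra.
Qed.

Lemma pos_selfadj x y : dot (T x) y = dot x (T y).
Proof. by rewrite pos_sym [RHS]dotC. Qed.

Lemma qf_cauchy x y : sqmod (dot (T x) y) <= qf x * qf y.
Proof.
have lT := pos_lin; set a := dot (T x) y.
(* Positivity at [x - t a y]. If [qf y] is positive, t is its inverse; if [qf y = 0], a large t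
   would make the expression negative unless a vanishes. *)
have key (t : R) : 0 <= qf x - 2 * t * sqmod a + t ^+ 2 * sqmod a * qf y.
  have := qf_ge0 (x - (t%:C * a) *: y).
  rewrite /qform linB // linZ // !(dotBl, dotBr, dotZl, dotZr) !qfE.
  rewrite (pos_sym x y) -/a.
  rewrite /sqmod; case: a => a1 a2 /=; nra.
have a0 := sqmod_ge0 a; have x0 := qf_ge0 x; have y0 := qf_ge0 y.
have [yz|yN0] := eqVneq (qf y) 0.
  have [->|aN0] := eqVneq (sqmod a) 0; first by rewrite mulr_ge0.
  have := key ((qf x + 1) / sqmod a).
  have -> : 2 * ((qf x + 1) / sqmod a) * sqmod a = 2 * (qf x + 1) by field.
  by rewrite yz; lra.
have yp : 0 < qf y by rewrite lt_neqAle eq_sym yN0.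
have := key (qf y)^-1.
have -> : qf x - 2 * (qf y)^-1 * sqmod a + (qf y)^-1 ^+ 2 * sqmod a * qf y =
  qf x - sqmod a / qf y by field.
by rewrite subr_ge0 ler_pdivrMr.
Qed.

Lemma qf0_ker x : qf x = 0 -> T x = 0.
Proof.
move=> h; apply: (@sqnorm_eq0 _ _ dot); have := qf_cauchy x (T x).
rewrite h mul0r dotxx sqmod_real; have := sqnorm_ge0 dot (T x) => h1 h2.
by apply/eqP; rewrite -sqrf_eq0 eq_le h2 sqr_ge0.
Qed.

End Positive.

(** * Eigenvectors of compact positive operators and singular numbers *)

(** Choice depending on all earlier values, as needed to pick a vector orthogonal to its
    predecessors or a maximum outside the indices already used. *)
Lemma list_choice (X : Type) (x0 : X) (P : seq X -> X -> Prop) :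
  (forall l, exists x, P l x) ->
  exists f : nat -> X, forall n, P (mkseq f n) (f n).
Proof.
move=> /choice[c hc].
pose l n := iter n (fun l => rcons l (c l)) [::].
exists (fun n => c (l n)) => n.
suff -> : mkseq (fun n => c (l n)) n = l n by exact: hc.
by elim: n => //= n IHn; rewrite mkseqS IHn.
Qed.

Section Compact.
Local Open Scope complex_scope.
Context {R : realType} {H : completeNormedModType R[i]}.
Variable dot : {dot H for (@Num.conj R[i])}.
Hypothesis hd : hilbert_dot dot.
Implicit Types (x y z : H) (T S : H -> H).
Local Notation n2 := (sqnorm dot).

Lemma compact_op_cluster T (x : nat -> H) : compact_op T ->
  (forall n, n2 (x n) <= 1) ->
  exists y, forall (eps : R) N, 0 < eps -> exists2 n, (N <= n)%N & n2 (T (x n) - y) < eps.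
Proof.
move=> [_ cT] x1; move: cT; rewrite precompactE => cT.
have [|y [_ cy]] := cT ((T \o x) @ \oo).
  exists 0%N => // n _ /=; apply: subset_closure; exists (x n) => //=.
  by rewrite (_ : 1 = 1%:C) // (norm_le_n2 hd) // expr1n.
exists y => eps N e0.
have FA : ((T \o x) @ \oo) [set T (x n) | n in [set n | (N <= n)%N]].
  by exists N => // n Nn; exists n.
have FB : nbhs y [set z | n2 (z - y) < eps].
  apply/nbhs_ballP; exists (Num.sqrt eps)%:C; first by rewrite /= ltcR sqrtr_gt0.
  move=> z; rewrite -ball_normE /ball_ /= (norm_lt_n2 hd) ?sqrtr_ge0 //.
  by rewrite sqr_sqrtr 1?ltW // sqnormBC.
by have [_ [[n Nn <-] h]] := cy _ _ FA FB; exists n.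
Qed.

(* If all eigenvalues were at least c, the images of the f j would stay at mutual
   distance at least c, against compactness. *)
Lemma compact_eigs_lt T (f : nat -> H) (s : nat -> R) (c : R) : compact_op T ->
  osys dot f predT -> (forall j, T (f j) = (s j)%:C *: f j) ->
  0 < c -> exists j, s j < c.
Proof.
move=> cT of_ Tf c0; apply: contrapT => hn.
have sc j : c <= s j by rewrite leNgt; apply/negP => h; apply: hn; exists j.
have nf j : n2 (f j) = 1 by rewrite /sqnorm of_ eqxx.
have [|y hy] := compact_op_cluster cT (x := f); first by move=> n; rewrite nf.
have e0 : 0 < c ^+ 2 / 4 by rewrite divr_gt0 // exprn_gt0.
have [n _ hn1] := hy _ 0%N e0.
have [m nm hm] := hy _ n.+1 e0.
have := sqnorm_tri dot (T (f n)) y (T (f m)); rewrite (sqnormBC dot y).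
have ort : dot (f n) (f m) = 0 by rewrite of_ ltn_eqF.
rewrite !Tf sqnormB !sqnormZ !sqmod_real dotZl dotZr ort !mulr0 /= subr0 !nf !mulr1 => h.
by have := sc n; have := sc m; move: hn1 hm h; rewrite !Tf; nra.
Qed.

Section Spectral.
Local Open Scope complex_scope.
Variable T : H -> H.
Hypotheses (cT : compact_op T) (pT : positive_op dot T).
Local Notation qf := (qform dot T).

Definition perp (l : seq (H * R)) x :=
  forall i, (i < size l)%N -> dot x (nth (0, 0) l i).1 = 0.
Definition eigs (l : seq (H * R)) := forall i, (i < size l)%N ->
  T (nth (0, 0) l i).1 = (nth (0, 0) l i).2%:C *: (nth (0, 0) l i).1.

Let lT : linear T := pos_lin hd pT.

Lemma perp_stable l x : eigs l -> perp l x -> perp l (T x).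
Proof.
move=> el px q ql; rewrite (pos_selfadj hd pT) el // dotZr px ?mulr0 //.
Qed.

Lemma perpZ l a x : perp l x -> perp l (a *: x).
Proof. by move=> px q ql; rewrite dotZl px ?mulr0. Qed.

Lemma qfZ (r : R) x : qf (r%:C *: x) = r ^+ 2 * qf x.
Proof.
rewrite /qform linZ // dotZl dotZr (qfE pT).
by rewrite (_ : Num.conj r%:C = r%:C) ?ReM_real //=; [ring | exact: conjc_real].
Qed.

(** Rayleigh principle on the orthogonal complement of [l]: a maximizing sequence of the form
    consists of approximate eigenvectors, and a cluster point of their images is an eigenvector for
    the supremum. *)
Lemma top_eigen l : eigs l -> exists q : H * R,
  [/\ perp l q.1, n2 q.1 = (0 < q.2)%R%:R, 0 <= q.2, T q.1 = q.2%:C *: q.1 &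
      forall x, perp l x -> qf x <= q.2 * n2 x].
Proof.
move=> el.
have [_ [M M0 hM]] := (bounded_opP hd T).1 pT.1.
pose A := [set qf x | x in [set x | perp l x /\ n2 x <= 1]].
have A0 : A 0.
  exists 0; last by rewrite /qform lin0 // dot0l.
  by split=> [q _|]; rewrite ?dot0l // sqnorm0.
have qle x : n2 x <= 1 -> qf x <= M + 1.
  move=> x1; have := cauchy_schwarz dot (T x) x; rewrite (qfE pT) sqmod_real.
  have := hM x; have := sqnorm_ge0 dot x; have := sqnorm_ge0 dot (T x); have := qf_ge0 pT x.
  by move=> h1 h2 h3 h4 h5; nra.
have supA : has_sup A.
  by split; [exists 0 | exists (M + 1) => _ [x [_ x1] <-]; exact: qle].
set lam := sup A.
have lam_ub x : perp l x -> n2 x <= 1 -> qf x <= lam.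
  by move=> px x1; apply: sup_upper_bound => //; exists x.
have lam0 : 0 <= lam by apply: sup_upper_bound.
have lam_top x : perp l x -> qf x <= lam * n2 x.
  move=> px; have [x0|xN0] := eqVneq (n2 x) 0.
    by rewrite (sqnorm_eq0 x0) /qform lin0 // dot0l sqnorm0 mulr0.
  have xp : 0 < n2 x by rewrite lt_neqAle eq_sym xN0 sqnorm_ge0.
  pose r := (Num.sqrt (n2 x))^-1.
  have r2 : r ^+ 2 = (n2 x)^-1 by rewrite exprVn sqr_sqrtr // ltW.
  have := lam_ub (r%:C *: x) (perpZ _ px).
  rewrite sqnormZ sqmod_real r2 mulVf // qfZ r2 => /(_ (lexx _)).
  by rewrite mulrC ler_pdivrMr.
(* Once the form vanishes on the complement, the zero vector is returned as padding. *)
have [lz|lN0] := eqVneq lam 0.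
  exists (0, 0); split=> //=.
  - by move=> q _; rewrite dot0l.
  - by rewrite sqnorm0 ltxx.
  - by rewrite lin0 // scaler0.
  - by move=> x /lam_top; rewrite lz.
have lp : 0 < lam by rewrite lt_neqAle eq_sym lN0.
have /choice[x hx] : forall n : nat, exists x, [/\ perp l x, n2 x <= 1 & lam - n.+1%:R^-1 < qf x].
  move=> n; have [] := @sup_adherent _ A (n.+1%:R^-1) _ supA.
    by rewrite invr_gt0 ltr0n.
  by move=> _ [x [px x1] <-] h; exists x.
(* Cauchy-Schwarz for the form, at [x n] and its image, gives [n2 (T (x n)) <= lam * qf (x n)],
   because the complement is invariant under [T]. *)
have res n : n2 (T (x n) - lam%:C *: x n) <= lam * n.+1%:R^-1.
  have [px x1 qx] := hx n.
  have Tq : n2 (T (x n)) <= lam * qf (x n).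
    have := qf_cauchy hd pT (x n) (T (x n)); rewrite dotxx sqmod_real.
    have := lam_top _ (perp_stable el px); have := qf_ge0 pT (x n).
    have [->|tN0] := eqVneq (n2 (T (x n))) 0; first by move=> h _ _; rewrite mulr_ge0.
    have tp : 0 < n2 (T (x n)) by rewrite lt_neqAle eq_sym tN0 sqnorm_ge0.
    move=> h1 h2 h3.
    have : n2 (T (x n)) * n2 (T (x n)) <= n2 (T (x n)) * (lam * qf (x n)).
      by rewrite -expr2; nra.
    by rewrite ler_pM2l.
  rewrite sqnormB sqnormZ sqmod_real dotZr (qfE pT).
  rewrite (_ : Num.conj lam%:C = lam%:C); last exact: conjc_real.
  rewrite ReM_real /=.
  have : lam ^+ 2 * n2 (x n) <= lam ^+ 2 by rewrite ler_piMr // sqr_ge0.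
  have : lam * (lam - n.+1%:R^-1) <= lam * qf (x n) by rewrite ler_pM2l // ltW.
  by move: (n.+1%:R^-1) => i; lra.
have [|y hy] := compact_op_cluster cT (x := x); first by move=> n; have [] := hx n.
have arch (d : R) : 0 < d -> exists N, forall n, (N <= n)%N -> lam * n.+1%:R^-1 < d.
  move=> d0; have /cvgrPdist_lt/(_ d d0)[N _ HN] : (lam * n.+1%:R^-1 : R) @[n --> \oo] --> (0 : R).
    by rewrite -(mulr0 lam); apply: cvgMr; exact: cvg_harmonic.
  by exists N => n /HN; rewrite sub0r normrN ger0_norm // mulr_ge0 // invr_ge0.
have Ty : T y = lam%:C *: y.
  apply/eqP; rewrite -subr_eq0; apply/eqP/(@sqnorm_eq0 _ _ dot)/eqP.
  rewrite eq_le sqnorm_ge0 andbT; apply/ler_addgt0Pr => d d0; rewrite add0r.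
  pose K := 8 * (M + 1) + 8 * lam ^+ 2.
  have K0 : 0 < K by rewrite /K; nra.
  have dK : 0 < d / K by rewrite divr_gt0.
  have [N HN] := arch _ dK.
  have [n Nn hn] := hy _ N dK.
  have rn := le_lt_trans (res n) (HN n Nn).
  have -> : T y - lam%:C *: y = (T (y - T (x n)) + T (T (x n) - lam%:C *: x n))
     + lam%:C *: (T (x n) - y).
    by rewrite !(linB lT) (linZ lT) scalerBr [X in _ = X + _]addrA subrK addrA subrK.
  apply: le_trans (sqnormD_le _ _ _) _; rewrite sqnormZ sqmod_real.
  have := sqnormD_le dot (T (y - T (x n))) (T (T (x n) - lam%:C *: x n)).
  have := hM (y - T (x n)); have := hM (T (x n) - lam%:C *: x n).
  rewrite (sqnormBC dot y).
  set a := n2 (T (x n) - y) in hn *; set b := n2 (T (x n) - _) in rn *.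
  have a0 : 0 <= a := sqnorm_ge0 _ _; have b0 : 0 <= b := sqnorm_ge0 _ _.
  move: hn rn; rewrite !ltr_pdivlMr // /K => h1 h2 h3 h4 h5.
  have := sqr_ge0 lam => l2.
  have : M * a <= (M + 1) * a by nra.
  have : M * b <= (M + 1) * b by nra.
  have : 0 <= lam ^+ 2 * b by nra.
  have : 0 <= lam ^+ 2 * a by nra.
  have : 0 <= (M + 1) * b by nra.
  have : 0 <= (M + 1) * a by nra.
  nra.
have py : perp l y.
  move=> i il; have pq (z : H) : perp l z -> dot z (nth (0, 0) l i).1 = 0 by apply.
  move: pq; set q := nth _ _ _ => pq; apply: (sqmod_small0) => d d0.
  have q1 : 0 < n2 q.1 + 1 by have := sqnorm_ge0 dot q.1; lra.
  have [n _ hn] := hy _ 0%N (divr_gt0 d0 q1).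
  have [px _ _] := hx n.
  have -> : dot y q.1 = dot (y - T (x n)) q.1.
    by rewrite dotBl (pq _ (perp_stable el px)) subr0.
  apply: le_lt_trans (cauchy_schwarz _ _ _) _; rewrite sqnormBC.
  move: hn; rewrite ltr_pdivlMr //; have := sqnorm_ge0 dot q.1.
  have := sqnorm_ge0 dot (T (x n) - y); nra.
(* If y were 0, the images would come close to 0, although [qf (x n)], close to [lam], bounds their
   norms from below. *)
have yp : 0 < n2 y.
  rewrite lt_neqAle eq_sym sqnorm_ge0 andbT; apply/eqP => y0.
  have l2 : 0 < lam / 2 by lra.
  have l4 : 0 < lam ^+ 2 / 4 by rewrite divr_gt0 // exprn_gt0.
  have [N HN] := arch _ (mulr_gt0 lp l2).
  have [n Nn] := hy _ N l4; rewrite (sqnorm_eq0 y0) subr0 => hn.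
  have [_ x1 qx] := hx n.
  have := HN n Nn; rewrite ltr_pM2l // => h.
  have := cauchy_schwarz dot (T (x n)) (x n); rewrite (qfE pT) sqmod_real.
  have : n2 (T (x n)) * n2 (x n) <= n2 (T (x n)) by rewrite ler_piMr // sqnorm_ge0.
  have : (lam / 2) ^+ 2 < qf (x n) ^+ 2.
    have : lam / 2 < qf (x n) by move: h qx; move: (n.+1%:R^-1) => i; lra.
    by move=> h'; rewrite ltr_pXn2r // ?nnegrE; lra.
  by rewrite exprMn exprVn; lra.
pose r := (Num.sqrt (n2 y))^-1.
have r2 : r ^+ 2 = (n2 y)^-1 by rewrite exprVn sqr_sqrtr // ltW.
exists (r%:C *: y, lam); split=> //=.
- exact: perpZ.
- by rewrite sqnormZ sqmod_real r2 mulVf ?gt_eqF // lp.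
- by rewrite linZ // Ty !scalerA mulrC.
Qed.

End Spectral.

End Compact.

Lemma to0_cvg {R : realType} (s : nat -> R) : (forall n, 0 <= s n) ->
  to0 s <-> s @ \oo --> (0 : R).
Proof.
move=> s0; split=> [h|/cvgrPdist_lt h eps e0].
  apply/cvgrPdist_lt => eps e0; have [N HN] := h _ e0.
  by exists N => // n /HN; rewrite sub0r normrN ger0_norm.
have [N _ HN] := h _ e0; exists N => n /HN.
by rewrite sub0r normrN ger0_norm.
Qed.

Lemma co_starP {R : realType} (s : nat -> R) :
  co_star s <-> [/\ forall n, 0 <= s n, nonincr s & to0 s].
Proof. by split=> -[s0 ni h]; split=> //; apply/to0_cvg. Qed.

(** At the first index k where the sequences differ, the larger value is attained by the smaller
    sequence only before k, where both agree, and by the larger sequence at k as well: the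
    multiplicities differ. *)
Lemma co_star_mult_unique {R : realType} (s t : nat -> R) : co_star s -> co_star t ->
  (forall lam : R, 0 < lam -> exists2 m : nat,
     ([set k | s k = lam] #= `I_m)%card & ([set k | t k = lam] #= `I_m)%card) ->
  s = t.
Proof.
move=> cs ct H; apply/funext => n.
have lem (u v : nat -> R) (k : nat) : co_star u -> co_star v ->
    (forall lam : R, 0 < lam -> exists2 m : nat,
     ([set k | u k = lam] #= `I_m)%card & ([set k | v k = lam] #= `I_m)%card) ->
    (forall i, (i < k)%N -> u i = v i) -> u k <= v k.
  move=> /co_starP[u0 uni _] /co_starP[v0 vni _] HH eqk; rewrite leNgt; apply/negP => vu.
  have [m hu hv] := HH (u k) (le_lt_trans (v0 k) vu).
  have fu : finite_set [set i | u i = u k] by apply/finite_setP; exists m.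
  have fv : finite_set [set i | v i = u k] by apply/finite_setP; exists m.
  have lt_k i : v i = u k -> (i < k)%N.
    by move=> vi; rewrite ltnNge; apply/negP => /vni; rewrite vi leNgt vu.
  have := card_fset_set hu; have := card_fset_set hv => <- => /esym/eqP.
  apply/negP; rewrite neq_ltn; apply/orP; left; apply: fproper_ltn_card.
  rewrite fproperE; apply/andP; split.
    apply/fsubsetP => i; rewrite !in_fset_set // !inE /= => vi.
    by rewrite eqk //; exact: lt_k.
  apply/negP => /fsubsetP/(_ k); rewrite !in_fset_set // !inE /= => /(_ erefl) h.
  by have := lt_k _ h; rewrite ltnn.
have [n0] := ubnP n; elim: n0 n => // n0 IH n; rewrite ltnS => nn0.
have eqk i : (i < n)%N -> s i = t i by move=> ? ; apply: IH; lia.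
apply/le_anti/andP; split; apply: lem => //.
  by move=> lam /H[m]; exists m.
by move=> i /eqk.
Qed.

Section Dimension.
Local Open Scope complex_scope.
Context {R : realType} {H : completeNormedModType R[i]}.

(** Uniqueness of coordinates makes the product of the two change-of-basis matrices the identity of
    size m, which forces m <= n. *)
Lemma has_dim_le (M : set H) m n : has_dim M m -> has_dim M n -> (m <= n)%N.
Proof.
move=> [b [bM hb]] [b' [b'M hb']].
have /choice[c hc] : forall i, exists c : {ffun 'I_n -> R[i]}, b i = \sum_j c j *: b' j.
  by move=> i; have [c [hc _]] := hb' _ (bM i); exists c.
have /choice[d hdd] : forall j, exists d : {ffun 'I_m -> R[i]}, b' j = \sum_i d i *: b i.
  by move=> i; have [d [hdd _]] := hb _ (b'M i); exists d.
pose C := \matrix_(i, j) c i j; pose D := \matrix_(j, k) d j k.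
apply: (@mulmx1_min _ _ _ C D); apply/matrixP => i k; rewrite !mxE.
have [u [_ hu]] := hb _ (bM i).
have h1 : u = [ffun k => \sum_j c i j * d j k].
  apply: hu; rewrite {1}hc; under eq_bigr => j _ do rewrite hdd scaler_sumr.
  rewrite exchange_big; apply: eq_bigr => k' _; rewrite ffunE scaler_suml.
  by apply: eq_bigr => j _; rewrite scalerA.
have h2 : u = [ffun k => (i == k)%:R].
  apply: hu; rewrite (bigD1 i) //= big1; first by rewrite ffunE eqxx scale1r addr0.
  by move=> j ji; rewrite ffunE eq_sym (negbTE ji) scale0r.
have : u k = (i == k)%:R by rewrite h2 ffunE.
by rewrite h1 ffunE => <-; apply: eq_bigr => j _; rewrite !mxE.
Qed.

Lemma has_dim_unique (M : set H) m n : has_dim M m -> has_dim M n -> m = n.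
Proof. by move=> h1 h2; apply/eqP; rewrite eqn_leq !(@has_dim_le M). Qed.
End Dimension.

(** * Spectral decomposition and singular numbers *)

Section Eigensystem.
Local Open Scope complex_scope.
Context {R : realType} {H : completeNormedModType R[i]}.
Variable dot : {dot H for (@Num.conj R[i])}.
Hypothesis hd : hilbert_dot dot.
Implicit Types (x y z : H) (T S : H -> H) (f : nat -> H) (s : nat -> R).
Local Notation n2 := (sqnorm dot).

(** The decomposition T = sum_j s_j f_j (x) f_j for all ranks at once: [f j] is a unit vector or 0
    according to [0 < s j], and the last clause puts everything orthogonal to the [f j] into the
    kernel. *)
Definition eigsys T f s := [/\ osys dot f (fun j => 0 < s j), co_star s,
  forall j, T (f j) = (s j)%:C *: f j &
  forall x, (forall j, dot x (f j) = 0) -> T x = 0].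

Theorem spectral T : compact_op T -> positive_op dot T -> exists f s, eigsys T f s.
Proof.
move=> cT pT.
pose P l (q : H * R) := eigs T l ->
    [/\ perp dot l q.1, n2 q.1 = (0 < q.2)%R%:R, 0 <= q.2, T q.1 = q.2%:C *: q.1 &
      forall x, perp dot l x -> qform dot T x <= q.2 * n2 x].
have [p hp] : exists p : nat -> H * R, forall n, P (mkseq p n) (p n).
  apply: list_choice (0, 0) _ _ => l.
  have [el|nel] := pselect (eigs T l); last by exists (0, 0) => /nel.
  by have [q hq] := top_eigen hd cT pT el; exists q.
have ep n : eigs T (mkseq p n).
  elim: n => [|n IHn] i; first by [].
  rewrite size_mkseq ltnS leq_eqVlt => /orP[/eqP ->|i_n].
    by rewrite nth_mkseq //; have [] := hp n IHn.
  rewrite nth_mkseq 1?ltnW //; have := IHn i.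
  by rewrite size_mkseq nth_mkseq //; apply.
have {}hp n := hp n (ep n).
pose f n := (p n).1; pose s n := (p n).2.
have s0 n : 0 <= s n by have [] := hp n.
have perp_mk x n : (forall i, (i < n)%N -> dot x (f i) = 0) -> perp dot (mkseq p n) x.
  by move=> h i; rewrite size_mkseq => i_n; rewrite nth_mkseq //; exact: h.
have of_ : osys dot f (fun j => 0 < s j).
  have lt_orth i j : (i < j)%N -> dot (f j) (f i) = 0.
    by move=> ij; have [h _ _ _ _] := hp j; have := h i; rewrite size_mkseq nth_mkseq //; apply.
  move=> i j; case: (ltngtP i j) => ij.
  - by rewrite dotC lt_orth // rmorph0.
  - by rewrite lt_orth.
  - have [_ h _ _ _] := hp j; rewrite ij /= dotxx h.
    by case: (0 < _).
have ni1 n : s n.+1 <= s n.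
  have [hperp n2p sp Tp _] := hp n.+1; have [_ _ _ _ top] := hp n.
  have [z|nz] := eqVneq (s n.+1) 0; first by rewrite z.
  have sp' : 0 < s n.+1 by rewrite lt_neqAle eq_sym nz.
  have := top (f n.+1) (perp_mk _ _ _); rewrite n2p -/(s n.+1) sp' mulr1.
  rewrite /qform Tp dotZl dotxx n2p -/(s n.+1) sp' mulr1 /=; apply => i i_n.
  by rewrite of_ gtn_eqF // ltnW.
have ni : nonincr s.
  move=> m n; elim: n => [|n IHn]; first by rewrite leqn0 => /eqP ->.
  by rewrite leq_eqVlt => /orP[/eqP -> //|/IHn]; apply: le_trans.
have Tf j : T (f j) = (s j)%:C *: f j by have [] := hp j.
have st0 : to0 s.
  move=> c c0; have [j sj] : exists j, s j < c.
    apply: contrapT => hn.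
    have sc j : c <= s j by rewrite leNgt; apply/negP => h; apply: hn; exists j.
    have osp : osys dot f predT by move=> i j; rewrite of_ (lt_le_trans c0).
    by apply: hn; exact: (compact_eigs_lt hd cT osp).
  by exists j => n jn; apply: le_lt_trans sj; exact: ni.
exists f, s; split=> //; first by apply/co_starP.
move=> x px; apply: (qf0_ker hd pT); apply/eqP; rewrite eq_le qf_ge0 // andbT.
apply/ler_addgt0Pr => d d0; rewrite add0r.
have n1 : 0 < n2 x + 1 by have := sqnorm_ge0 dot x; lra.
have [n hn] := ultimately_ex (st0 _ (divr_gt0 d0 n1)).
have [_ _ _ _ top] := hp n; apply: le_trans (top x (perp_mk _ _ _)) _ => //.
by move: hn; rewrite ltr_pdivlMr // -/(s n); have := sqnorm_ge0 dot x; have := s0 n; nra.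
Qed.

Section WithSystem.
Local Open Scope complex_scope.
Variables (T : H -> H) (f : nat -> H) (s : nat -> R).
Hypotheses (pT : positive_op dot T) (es : eigsys T f s).

Let of_ : osys dot f (fun j => 0 < s j) := let: And4 h _ _ _ := es in h.
Let cs : co_star s := let: And4 _ h _ _ := es in h.
Let Tf : forall j, T (f j) = (s j)%:C *: f j := let: And4 _ _ h _ := es in h.
Let Tker : forall x, (forall j, dot x (f j) = 0) -> T x = 0 := let: And4 _ _ _ h := es in h.
Let lT : linear T := pos_lin hd pT.

Lemma eig_vec0 j : s j = 0 -> f j = 0.
Proof. by move=> sj; apply: (@sqnorm_eq0 _ _ dot); rewrite /sqnorm of_ sj ltxx andbF. Qed.

Lemma eig_oproj x : T (oproj dot f x) = T x.
Proof.
have : T (x - oproj dot f x) = 0 by apply: Tker => j; exact: (oproj_perp hd of_).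
by rewrite linB // => /eqP; rewrite subr_eq0 => /eqP ->.
Qed.

Lemma eig_expand x :
  psum (fun k => (s k)%:C * dot x (f k)) f @ \oo --> T x.
Proof.
rewrite -eig_oproj.
have := cvg_bounded_op hd pT.1 (oproj_cvg hd of_ x).
rewrite (_ : _ \o _ = psum (fun k => (s k)%:C * dot x (f k)) f) //.
apply/funext => n /=; rewrite /psum lin_sum //; apply: eq_bigr => k _.
by rewrite linZ // Tf scalerA mulrC.
Qed.

(* A positive root S of T \o T acts on an eigenvector f j as s j: for
   y = S (f j) - s j f j one has S y = - s j y, so y = 0 by positivity. *)
Lemma abs_op_pos (e : nat -> H) : orthonormal_basis dot e -> abs_op dot T = T.
Proof.
move=> he.
have adjT : adjoint dot T = T.
  by apply: (adjoint_unique hd he) => //; [exact: pT.1|exact: pT.1|exact: pos_selfadj].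
apply: xget_unique; first by split=> //; rewrite adjT.
move=> S [pS]; rewrite adjT => SS.
have lS := pos_lin hd pS.
have SST x : S (S x) = T (T x) by have := congr1 (fun g => g x) SS.
have Sf j : S (f j) = (s j)%:C *: f j.
  have [z|nz] := eqVneq (s j) 0; first by rewrite eig_vec0 // lin0 // scaler0.
  have s0 : 0 < s j by rewrite lt_neqAle eq_sym nz; have [->] := cs.
  pose y := S (f j) - (s j)%:C *: f j.
  have Sy : S y = - ((s j)%:C *: y).
    by rewrite /y linB // linZ // SST Tf linZ // Tf scalerBr opprB.
  have := qf_ge0 pS y; rewrite /qform Sy dotNl dotZl dotxx raddfN /= mul0r subr0 => h.
  suff /sqnorm_eq0/eqP : n2 y = 0 by rewrite subr_eq0 => /eqP.
  by have := sqnorm_ge0 dot y; nra.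
have Sker z : T z = 0 -> S z = 0.
  move=> Tz; apply: (@sqnorm_eq0 _ _ dot); rewrite /sqnorm.
  by rewrite (pos_selfadj hd pS) SST Tz lin0 // dot0r.
apply/funext => x.
have -> : S x = S (oproj dot f x).
  have : S (x - oproj dot f x) = 0 by apply: Sker; rewrite linB // eig_oproj subrr.
  by rewrite linB // => /eqP; rewrite subr_eq0 => /eqP.
apply: sqnorm_lim_unique (eig_expand (x := x)).
have := cvg_bounded_op hd pS.1 (oproj_cvg hd of_ x).
rewrite (_ : _ \o _ = psum (fun k => (s k)%:C * dot x (f k)) f) //.
apply/funext => n /=; rewrite /psum lin_sum //; apply: eq_bigr => k _.
by rewrite linZ // Sf scalerA mulrC.
Qed.

(** By monotonicity the indices with [s k = lam] form an interval. The [f] on it span the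
    eigenspace: for an eigenvector x with projection w onto them, [x - w] is orthogonal to all
    [f j], so [T] kills it, while [T] also multiplies it by [lam]. *)
Lemma eig_mult (lam : R) : 0 < lam -> exists2 m : nat,
  ([set k | s k = lam] #= `I_m)%card & has_dim [set x | T x = lam%:C *: x] m.
Proof.
move=> lp; have /co_starP[s0 ni st0] := cs.
have ex_r : exists r, s r < lam by apply: ultimately_ex; exact: st0.
have ex_p : exists p, s p <= lam by have [r /ltW] := ex_r; exists r.
case: (ex_minnP ex_r) => r sr rmin; case: (ex_minnP ex_p) => p sp pmin.
have pr : (p <= r)%N by apply: pmin; exact: ltW.
have lev k : s k = lam <-> (p <= k < r)%N.
  split=> [sk|/andP[pk kr]].
    apply/andP; split; first by apply: pmin; rewrite sk.
    by rewrite ltnNge; apply/negP => /ni; rewrite sk leNgt sr.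
  apply/le_anti/andP; split; first exact: le_trans (ni _ _ pk) sp.
  by rewrite leNgt; apply/negP => /rmin; rewrite leqNgt kr.
exists (r - p)%N.
  have -> : [set k | s k = lam] = (addn p) @` `I_(r - p).
    apply/seteqP; split=> k /=.
      by move=> /lev/andP[pk kr]; exists (k - p)%N => /=; lia.
    by move=> [i /= ir <-]; apply/lev; lia.
  by apply: inj_card_eq => i j _ _ /addnI.
have slam (i : 'I_(r - p)) : s (p + i) = lam by apply/lev; have := ltn_ord i; lia.
exists (fun i : 'I_(r - p) => f (p + i)%N); split=> [i /=|x /= Tx].
  by rewrite Tf slam.
have coefE (c : {ffun 'I_(r - p) -> R[i]}) (j : 'I_(r - p)) :
    dot (\sum_i c i *: f (p + i)%N) (f (p + j)%N) = c j.
  rewrite dot_suml (bigD1 j) //= big1; last first.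
    move=> i ij; rewrite dotZl of_ eqn_add2l.
    by rewrite -(inj_eq val_inj) in ij; rewrite (negbTE ij) /= mulr0.
  by rewrite addr0 dotZl of_ eqxx slam lp mulr1.
exists [ffun i : 'I_(r - p) => dot x (f (p + i)%N)]; split; last first.
  by move=> c xc; apply/ffunP => j; rewrite ffunE xc coefE.
set w := \sum_i _.
have dw j : dot (x - w) (f j) = 0.
  case: (boolP ((p <= j < r)%N)) => hj.
    have jr : (j - p < r - p)%N by lia.
    have := coefE [ffun i : 'I_(r - p) => dot x (f (p + i)%N)] (Ordinal jr).
    rewrite /= subnKC; last by lia.
    by rewrite dotBl -/w ffunE /= subnKC => [->|]; [rewrite subrr | lia].
  have -> : dot w (f j) = 0 -> dot (x - w) (f j) = dot x (f j) by rewrite dotBl => ->; rewrite subr0.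
    have : (s j)%:C * dot x (f j) = lam%:C * dot x (f j).
      rewrite -(dotZl _ lam%:C) -Tx (pos_selfadj hd pT) Tf dotZr.
      by congr (_ * _); exact/esym/conjc_real.
    move/eqP; rewrite -subr_eq0 -mulrBl mulf_eq0 => /orP[|/eqP //].
    rewrite subr_eq0 => /eqP/complexI/lev; by rewrite (negbTE hj).
  rewrite dot_suml big1 // => i _; rewrite dotZl of_.
  by rewrite (_ : (p + i == j)%N = false) ?mulr0 //; have := ltn_ord i; lia.
have Tw : T w = lam%:C *: w.
  rewrite lin_sum // scaler_sumr; apply: eq_bigr => i _.
  by rewrite linZ // Tf slam !scalerA mulrC.
have : T (x - w) = 0 by exact: Tker.
rewrite linB // Tx Tw -scalerBr => /eqP; rewrite scaler_eq0 subr_eq0 => /orP[|/eqP //].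
by rewrite (_ : 0 = 0%:C) // => /eqP/complexI => l0; rewrite l0 ltxx in lp.
Qed.

Lemma sing_eig (e : nat -> H) : orthonormal_basis dot e -> sing dot T = s.
Proof.
move=> he; have absT := abs_op_pos he.
apply: xget_unique.
  by split=> [//|lam lp]; rewrite absT; exact: eig_mult.
move=> t [ct ht]; apply: co_star_mult_unique => // lam lp.
have [m hm dm] := ht _ lp; have [m' hm' dm'] := eig_mult lp.
by rewrite absT in dm; exists m => //; rewrite (has_dim_unique dm dm').
Qed.

End WithSystem.
End Eigensystem.

(** * Diagonal operators *)

Lemma ultra_bounded_lim {R : realType} {T : Type} (F : set_system T) (h : T -> R) (M : R) :
  UltraFilter F -> F [set x | `|h x| <= M] ->
  exists a : R, forall eps : R, 0 < eps -> F [set x | `|h x - a| < eps].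
Proof.
move=> UF FM.
have [|a [_ ca]] := @segment_compact R (- M) M (h @ F) _.
  by move: FM; apply: (@filterS _ F) => x /=; rewrite in_itv /= -ler_norml.
exists a => eps e0.
have [//|FC] := in_ultra_setVsetC [set x | `|h x - a| < eps] UF.
have hF : (h @ F) [set y | eps <= `|y - a|].
  by move: FC; apply: (@filterS _ F) => x /=; rewrite leNgt => /negP.
have [y [/= h1 h2]] := ca _ _ hF (nbhsx_ballx a eps e0).
by move: h2; rewrite /ball /= distrC ltNge h1.
Qed.

Section Precompact.
Local Open Scope complex_scope.
Context {R : realType} {H : completeNormedModType R[i]}.
Variable dot : {dot H for (@Num.conj R[i])}.
Hypothesis hd : hilbert_dot dot.
Variable e : nat -> H.
Hypothesis he : orthonormal_basis dot e.
Implicit Types (x y z : H).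
Local Notation n2 := (sqnorm dot).
Local Notation coef x := (fun k => dot x (e k)).
Local Notation trunc n x := (psum (coef x) e n).

Lemma sqnorm_trunc n x : n2 (trunc n x) = \sum_(0 <= k < n) sqmod (dot x (e k)).
Proof.
rewrite /psum (sqnorm_osum (basis_osys he)); apply: eq_bigr => k _.
by rewrite mulr1.
Qed.

Lemma truncB n x y : trunc n (x - y) = trunc n x - trunc n y.
Proof.
rewrite /psum -sumrB; apply: eq_bigr => k _.
by rewrite dotBl scalerBl.
Qed.

Lemma sqnorm_trunc_le n x : n2 (trunc n x) <= n2 x.
Proof. by rewrite sqnorm_trunc; exact: (bessel_fin (basis_osys he)). Qed.

Lemma closureP (A : set H) x : closure A x ->
  forall eps : R, 0 < eps -> exists2 y, A y & n2 (x - y) < eps.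
Proof.
move=> cx eps e0.
have [|y [Ay hy]] := cx (ball x (Num.sqrt eps)%:C).
  by apply: nbhsx_ballx; rewrite ltcR sqrtr_gt0.
exists y => //; move: hy; rewrite -ball_normE /ball_ /= (norm_lt_n2 hd) ?sqrtr_ge0 //.
by rewrite sqr_sqrtr 1?ltW.
Qed.

(** Along an ultrafilter every coordinate converges, being bounded; uniformly small tails reduce the
    Cauchy property to finitely many coordinates. *)
Lemma precompact_tails (A : set H) (M : R) : (forall x, A x -> n2 x <= M) ->
  (forall eps : R, 0 < eps -> exists n, forall x, A x -> n2 (x - trunc n x) <= eps) ->
  precompact A.
Proof.
move=> bA tA; rewrite precompactE compact_ultra => F UF FA.
have bcl x : closure A x -> n2 x <= 2 * M + 2.
  move=> /closureP/(_ _ ltr01)[y Ay hy].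
  by have := sqnorm_tri dot x y 0; rewrite !subr0; have := bA y Ay; lra.
have tcl eps : 0 < eps -> exists n, forall x, closure A x -> n2 (x - trunc n x) <= eps.
  move=> e0; have e4 : 0 < eps / 16 by lra.
  have [n hn] := tA _ e4; exists n => x /closureP/(_ _ e4)[y Ay hy].
  have -> : x - trunc n x = ((x - y) - trunc n (x - y)) + (y - trunc n y).
    by rewrite truncB opprB [in RHS]addrAC !addrA !subrK.
  apply: le_trans (sqnormD_le _ _ _) _.
  have h1 := sqnormD_le dot (x - y) (- trunc n (x - y)).
  have := sqnorm_trunc_le n (x - y); have := hn y Ay; rewrite sqnormN in h1; lra.
have /choice[c hc] : forall k, exists c : R[i], forall eps : R, 0 < eps ->
    F [set x | sqmod (dot x (e k) - c) < eps].
  move=> k.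
  have bk x : closure A x -> sqmod (dot x (e k)) <= 2 * M + 2.
    move=> /bcl; apply: le_trans; apply: le_trans (cauchy_schwarz _ _ _) _.
    by rewrite (sqnorm_basis he) mulr1.
  have sq_le (r : R) : r ^+ 2 <= 2 * M + 2 -> `|r| <= 2 * M + 3.
    move=> h; have r2 := sqr_ge0 r.
    rewrite -(@ler_pXn2r _ 2) ?nnegrE ?real_normK ?num_real //; last lra.
    have M2 : 0 <= 2 * M + 2 by lra.
    by apply: le_trans h _; rewrite (_ : 2 * M + 3 = (2 * M + 2) + 1); [nra | ring].
  have [a ha] : exists a : R, forall eps : R, 0 < eps ->
      F [set x | `|complex.Re (dot x (e k)) - a| < eps].
    apply: (@ultra_bounded_lim _ _ _ _ (2 * M + 3)).
    apply: filterS FA => x /bk h /=; apply: sq_le; exact: le_trans (sqmod_Re _) h.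
  have [b hb] : exists b : R, forall eps : R, 0 < eps ->
      F [set x | `|complex.Im (dot x (e k)) - b| < eps].
    apply: (@ultra_bounded_lim _ _ _ _ (2 * M + 3)).
    apply: filterS FA => x /bk h /=; apply: sq_le; apply: le_trans h.
    by rewrite /sqmod lerDr sqr_ge0.
  exists (a +i* b) => eps e0.
  have e1 : 0 < Num.sqrt (eps / 2) by rewrite sqrtr_gt0; lra.
  apply: filterS (filterI (ha _ e1) (hb _ e1)) => x /= [].
  have sqlt (r : R) : `|r| < Num.sqrt (eps / 2) -> r ^+ 2 < eps / 2.
    rewrite -(@ltr_pXn2r _ 2) ?nnegrE ?sqrtr_ge0 // sqr_sqrtr; last lra.
    by rewrite real_normK ?num_real.
  rewrite /sqmod; case: (dot x (e k)) => u v /= /sqlt h1 /sqlt h2; lra.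
suff /cauchy_cvgP cF : cauchy F.
  exists (lim F); split => //.
  by apply: (closed_cvg (closure A)) cF => //; exact: closed_closure.
apply/cauchyP => _ /pos_complex[eps e0 ->].
have e2 : 0 < eps ^+ 2 / 4 by rewrite divr_gt0 // exprn_gt0.
have [n hn] := tcl _ e2.
pose y := \sum_(0 <= k < n) c k *: e k.
have Fk : F [set x | forall k, (k < n)%N -> sqmod (dot x (e k) - c k) < eps ^+ 2 / 4 / n.+1%:R].
  have ep : 0 < eps ^+ 2 / 4 / n.+1%:R by rewrite divr_gt0.
  elim: n {hn y} (eps ^+ 2 / 4 / n.+1%:R) ep => [|n IHn] r r0; first by apply: filterE.
  apply: filterS (filterI (IHn r r0) (hc n r r0)) => x /= [h1 h2] k.
  by rewrite ltnS leq_eqVlt => /orP[/eqP ->|/h1].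
exists y; apply: filterS (filterI FA Fk) => x /= [Ax hx].
rewrite -ball_normE /ball_ /= (norm_lt_n2 hd) ?(ltW e0) //.
have := sqnorm_tri dot y (trunc n x) x.
have := hn x Ax; rewrite sqnormBC => h1.
suff : n2 (y - trunc n x) < eps ^+ 2 / 4 by lra.
rewrite sqnormBC /y /psum -sumrB.
under eq_bigr do rewrite -scalerBl.
rewrite (sqnorm_osum (basis_osys he)).
apply: (@le_lt_trans _ _ (\sum_(0 <= k < n) eps ^+ 2 / 4 / n.+1%:R)).
  rewrite big_nat [leRHS]big_nat; apply: ler_sum => k /andP[_ kn].
  by rewrite mulr1 ltW // hx.
rewrite sumr_const_nat subn0 -[_ *+ n]mulr_natr mulrAC ltr_pdivrMr ?ltr0n //.
by rewrite ltr_pM2l // ltr_nat.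
Qed.

End Precompact.

(** * Nonincreasing rearrangement of a null sequence *)

Lemma frequently_subseq (P : nat -> Prop) :
  (forall N, exists2 n, (N <= n)%N & P n) ->
  exists nu : nat -> nat, {homo nu : i j / (i < j)%N} /\ forall i, P (nu i).
Proof.
move=> H; have /choice[c hc] : forall N, exists n, (N <= n)%N /\ P n.
  by move=> N; have [n ? ?] := H N; exists n.
pose nu i := iter i (fun n => c n.+1) (c 0%N).
exists nu; split; last by case=> [|i]; exact: (hc _).2.
apply: homo_ltn => [? ? ?|i]; first exact: ltn_trans.
exact: (hc (nu i).+1).1.
Qed.

Lemma mem_mkseq_ex (T : eqType) (f : nat -> T) n k :
  k \in mkseq f n -> exists2 i, (i < n)%N & k = f i.
Proof. by case/mapP => i; rewrite mem_iota => /andP[_ h] ->; exists i. Qed.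

Section Rearrangement.
Local Open Scope complex_scope.
Context {R : realType}.
Variable d : nat -> R.
Hypotheses (d0 : forall k, 0 <= d k) (d_to0 : to0 d).

Lemma max_outside (l : seq nat) : exists k, k \notin l /\ forall k', k' \notin l -> d k' <= d k.
Proof.
have [k0 hk0] : exists k0, k0 \notin l.
  exists (\max_(i <- l) i).+1; apply/negP => h.
  by have := @leq_bigmax_seq _ l (fun=> true) id _ h isT; rewrite ltnn.
have [all0|] := pselect (forall k, k \notin l -> d k = 0).
  by exists k0; split=> // k' hk'; rewrite !all0.
move/existsNP => [k1 /not_implyP[hk1 /eqP dk1]].
have dp : 0 < d k1 by rewrite lt_neqAle eq_sym dk1 d0.
have [N HN] := d_to0 dp.
have k1N : (k1 < N)%N.
  by rewrite ltnNge; apply/negP => /HN; rewrite ltxx.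
case: (@Order.TotalTheory.arg_maxP _ _ 'I_N (Ordinal k1N)
  (fun i : 'I_N => nat_of_ord i \notin l) (fun i => d i) hk1) => i il imax.
exists (nat_of_ord i); split=> // k' hk'; case: (ltnP k' N) => k'N.
  exact: (imax (Ordinal k'N)).
by apply: le_trans (imax (Ordinal k1N) hk1); apply/ltW/HN.
Qed.

(** Successive maxima. A bijection is impossible in general: with infinitely many positive entries,
    sorting never reaches the zeros. Hence injectivity together with vanishing outside the range. *)
Lemma rearrangement : exists kappa : nat -> nat,
  [/\ injective kappa, nonincr (d \o kappa), to0 (d \o kappa) &
      forall k, (forall i, kappa i != k) -> d k = 0].
Proof.
have [ka hk] := list_choice 0%N max_outside.
have mem_mk i n : (i < n)%N -> ka i \in mkseq ka n.
  by move=> i_n; apply/mapP; exists i; rewrite ?mem_iota.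
have inj : injective ka.
  have lt_neq i j : (i < j)%N -> ka i != ka j.
    by move=> ij; apply/eqP => e; have [/negP[]] := hk j; rewrite -e; exact: mem_mk.
  move=> i j e; case: (ltngtP i j) => // /lt_neq; by rewrite e eqxx.
have ni : nonincr (d \o ka).
  move=> m n mn /=; have [_] := hk m; apply.
  apply/negP => /mem_mkseq_ex[i im /inj nm].
  by move: im; rewrite -nm ltnNge mn.
have t0 : to0 (d \o ka).
  move=> c c0; have [N HN] := d_to0 c0.
  have [m hm] := injective_gtn inj N.
  by exists m => n mn; apply: le_lt_trans (HN _ (ltnW hm)); exact: ni.
exists ka; split=> // k hk'; apply/eqP; rewrite eq_le d0 andbT leNgt.
apply/negP => dk; have [N HN] := t0 _ dk.
have := HN N (leqnn N); apply/negP; rewrite -leNgt /=.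
have [_] := hk N; apply; apply/negP => /mem_mkseq_ex[i _ e].
by have := hk' i; rewrite e eqxx.
Qed.

End Rearrangement.

Section Diagonal.
Local Open Scope complex_scope.
Context {R : realType} {H : completeNormedModType R[i]}.
Variable dot : {dot H for (@Num.conj R[i])}.
Hypothesis hd : hilbert_dot dot.
Variable e : nat -> H.
Hypothesis he : orthonormal_basis dot e.
Implicit Types (x y z : H) (d : nat -> R).
Local Notation n2 := (sqnorm dot).

Definition diagop d x : H := hsum (fun k => (d k)%:C * dot x (e k)) e.

Lemma diag_sqsum d (D : R) x : (forall k, 0 <= d k <= D) ->
  forall n, \sum_(0 <= k < n) sqmod ((d k)%:C * dot x (e k)) <= D ^+ 2 * n2 x.
Proof.
move=> dD n.
apply: (@le_trans _ _ (\sum_(0 <= k < n) D ^+ 2 * sqmod (dot x (e k)))).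
  apply: ler_sum => k _; rewrite sqmodM sqmod_real ler_wpM2r ?sqmod_ge0 //.
  by have /andP[? ?] := dD k; rewrite ler_pXn2r // nnegrE //; apply: le_trans (_ : d k <= _).
by rewrite -mulr_sumr ler_wpM2l ?sqr_ge0 //; exact: (bessel_fin (basis_osys he)).
Qed.

Section Bounded.
Local Open Scope complex_scope.
Variables (d : nat -> R) (D : R).
Hypothesis dD : forall k, 0 <= d k <= D.

Let sqs x : sqsum (fun k => (d k)%:C * dot x (e k)).
Proof. by exists (D ^+ 2 * n2 x) => n; exact: diag_sqsum. Qed.

Lemma dot_diagop x k : dot (diagop d x) (e k) = (d k)%:C * dot x (e k).
Proof. by rewrite /diagop (dot_hsum hd (basis_osys he)) // mulr1. Qed.

Lemma diagop_bounded : bounded_op (diagop d).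
Proof.
apply/(bounded_opP hd); split.
  move=> a x y; apply: (basis_eq hd he) => k.
  by rewrite dotDl dotZl !dot_diagop dotDl dotZl; ring.
exists (D ^+ 2) => [|x]; first exact: sqr_ge0.
apply: (sqnorm_le_lim hd) (psum_cvg hd (basis_osys he) (sqs x)) _ => n.
rewrite /psum (sqnorm_osum (basis_osys he)); apply: le_trans (diag_sqsum x dD n).
by apply: ler_sum => k _; rewrite mulr1.
Qed.

Lemma diagop_basis k : diagop d (e k) = (d k)%:C *: e k.
Proof.
apply: (basis_eq hd he) => j; rewrite dot_diagop dotZl he.1.
by case: eqVneq => [->|_]; rewrite ?mulr0.
Qed.

Lemma dot_lim_ge0 (u : nat -> H) (l y : H) : u @ \oo --> l ->
  (forall n, 0 <= dot (u n) y) -> 0 <= dot l y.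
Proof.
move=> ul h; have key eps : 0 < eps -> exists2 r : R, 0 <= r &
    (r - complex.Re (dot l y)) ^+ 2 + complex.Im (dot l y) ^+ 2 < eps.
  move=> e0; have [n] := ultimately_ex (cvg_dotl hd y ul e0); have := h n.
  case: (dot (u n) y) => a b; rewrite lecE /= => /andP[/eqP -> a0].
  rewrite /sqmod; case: (dot l y) => p q /=; rewrite sub0r sqrrN => hh.
  by exists a.
case: (dot l y) key => p q /= key; rewrite lecE /=; apply/andP; split.
  apply/eqP/eqP; rewrite -sqrf_eq0 eq_le sqr_ge0 andbT; apply/ler_addgt0Pr => eps e0.
  have [r r0 hr] := key _ e0; rewrite add0r ltW //; apply: le_lt_trans hr.
  by rewrite lerDr sqr_ge0.
rewrite leNgt; apply/negP => p0.
have p2 : 0 < p ^+ 2 by rewrite exprn_even_gt0 //= lt_eqF.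
have [r r0] := key _ p2; apply/negP; rewrite -leNgt.
by have := sqr_ge0 q; nra.
Qed.

Lemma diagop_positive : positive_op dot (diagop d).
Proof.
split=> [|x]; first exact: diagop_bounded.
apply: dot_lim_ge0 (psum_cvg hd (basis_osys he) (sqs x)) _ => n.
rewrite /psum dot_suml sumr_ge0 // => k _.
rewrite dotZl -mulrA (dotC dot (e k)) -sqmod_mulconj -rmorphM ler0c mulr_ge0 ?sqmod_ge0 //.
by have /andP[] := dD k.
Qed.

Lemma diagop_diagonal : diagonal_op dot e (diagop d).
Proof.
split=> [|i j ij]; first exact: diagop_bounded.
by rewrite diagop_basis dotZl he.1; case: eqVneq => [/esym|]; rewrite ?mulr0.
Qed.

Lemma diagop_compact : to0 d -> compact_op (diagop d).
Proof.
move=> d0; split; first exact: diagop_bounded.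
have [_ [M M0 hM]] := (bounded_opP hd _).1 diagop_bounded.
have ball1 x : `|x| <= 1 -> n2 x <= 1.
  by rewrite (_ : 1 = 1%:C) // (norm_le_n2 hd) // expr1n.
apply: (precompact_tails hd he (M := M)) => [_ [x /= /ball1 x1 <-]|eps e0].
  by apply: le_trans (hM x) _; rewrite ler_piMr.
have [|N HN] := d0 (Num.sqrt eps); first by rewrite sqrtr_gt0.
exists N => _ [x /= /ball1 x1 <-].
have bd := bessel_fin (basis_osys he) x.
apply: (sqnorm_le_lim hd (u := fun n => psum (fun k => dot (diagop d x) (e k)) e (n + N)%N -
    psum (fun k => dot (diagop d x) (e k)) e N)).
  apply: cvgB; last exact: cvg_cst.
  by rewrite (cvg_shiftn N (psum _ e)); exact: basis_psum_cvg.
move=> n; rewrite /psum (big_cat_nat (n := N)) ?leq_addl //= addrAC subrr add0r.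
rewrite (sqnorm_osum (basis_osys he)).
apply: (@le_trans _ _ (\sum_(N <= k < n + N) eps * sqmod (dot x (e k)))).
  rewrite big_nat [leRHS]big_nat; apply: ler_sum => k /andP[Nk _].
  rewrite mulr1 dot_diagop sqmodM sqmod_real ler_wpM2r ?sqmod_ge0 //.
  have /andP[dk _] := dD k; have := HN k Nk => h.
  by rewrite -(sqr_sqrtr (ltW e0)) ler_pXn2r ?nnegrE ?sqrtr_ge0 // ltW.
rewrite -mulr_sumr ler_piMr ?(ltW e0) //; apply: le_trans x1.
apply: le_trans (bd (n + N)%N).
rewrite [leRHS](big_cat_nat (n := N)) ?leq_addl //= lerDr sumr_ge0 // => k _.
exact: sqmod_ge0.
Qed.

Lemma diagop_eigsys (kappa : nat -> nat) :
  injective kappa -> nonincr (d \o kappa) -> to0 (d \o kappa) ->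
  (forall k, (forall i, kappa i != k) -> d k = 0) ->
  eigsys dot (diagop d) (fun i => if 0 < d (kappa i) then e (kappa i) else 0) (d \o kappa).
Proof.
move=> inj ni t0 off; split.
- move=> i j /=; case: ifP => di; case: ifP => dj; rewrite ?dot0l ?dot0r ?he.1.
  + by rewrite (inj_eq inj) andbT.
  + by case: eqVneq => // ij; rewrite ij dj in di.
  + by rewrite andbF.
  + by rewrite andbF.
- by apply/co_starP; split=> // n /=; have /andP[] := dD (kappa n).
- move=> j /=; case: ifP => dj; first exact: diagop_basis.
  by rewrite scaler0 (lin0 ((bounded_opP hd _).1 diagop_bounded).1).
- move=> x hx; apply: (basis_eq hd he) => k; rewrite dot_diagop dot0l.
  have [[i ik]|nk] := pselect (exists i, kappa i = k).
    have := hx i; rewrite ik; case: ifP => [_ ->|dk _]; first by rewrite mulr0.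
    have -> : d k = 0.
      by apply/eqP; rewrite eq_le leNgt dk; have /andP[] := dD k.
    by rewrite mul0r.
  rewrite off ?mul0r // => i; apply/eqP => ik; by apply: nk; exists i.
Qed.

End Bounded.

Lemma to0_bounded d : (forall k, 0 <= d k) -> to0 d -> exists D, forall k, 0 <= d k <= D.
Proof.
move=> d0 dt; have [ka [inj ni t0 off]] := rearrangement d0 dt.
exists (d (ka 0%N)) => k; rewrite d0 /=.
have [[i <-]|nk] := pselect (exists i, ka i = k); first exact: (ni 0%N i).
by rewrite off ?d0 // => i; apply/eqP => ik; apply: nk; exists i.
Qed.

Section OfOperator.
Local Open Scope complex_scope.
Variable B : H -> H.
Hypotheses (dB : diagonal_op dot e B) (cB : compact_op B) (pB : positive_op dot B).

Definition diag_of (T : H -> H) k : R := complex.Re (dot (T (e k)) (e k)).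

Lemma diagonal_basis k : B (e k) = (diag_of B k)%:C *: e k.
Proof.
apply: (basis_eq hd he) => j; rewrite dotZl he.1.
case: eqVneq => [<-|kj]; first by rewrite mulr1 (qfE pB).
by rewrite mulr0 dB.2 //; apply/eqP; rewrite eq_sym.
Qed.

Lemma diag_of_ge0 (T : H -> H) k : positive_op dot T -> 0 <= diag_of T k.
Proof. by move=> pT; exact: (qf_ge0 pT). Qed.

(** Entries that stay above [c] along a subsequence would be eigenvalues of an infinite orthonormal
    family. *)
Lemma diag_of_to0 : to0 (diag_of B).
Proof.
move=> c c0; apply: contrapT => hn.
have [N|nu [numono hnu]] := @frequently_subseq (fun n => c <= diag_of B n).
  apply: contrapT => hN; apply: hn; exists N => M NM.
  by rewrite ltNge; apply/negP => h; apply: hN; exists M.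
have [||j] := @compact_eigs_lt _ _ _ hd B (e \o nu) (diag_of B \o nu) c cB _ _ c0.
- move=> i j /=; rewrite he.1 andbT; congr (nat_of_bool _)%:R.
  apply/eqP/eqP => [|-> //]; case: (ltngtP i j) => // /numono; lia.
- by move=> j /=; exact: diagonal_basis.
by rewrite ltNge /= hnu.
Qed.

Lemma diagonal_diagop : B = diagop (diag_of B).
Proof.
have [D hD] := to0_bounded (fun k => diag_of_ge0 k pB) diag_of_to0.
apply/funext => x; apply: (basis_eq hd he) => k.
rewrite (dot_diagop hD) (pos_selfadj hd pB) diagonal_basis dotZr.
by congr (_ * _); exact: conjc_real.
Qed.

End OfOperator.

Lemma cond_expE (T : H -> H) : positive_op dot T -> cond_exp dot e T = diagop (diag_of T).
Proof.
move=> pT; apply/funext => x; rewrite /cond_exp /diagop /hsum.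
by under eq_fun do rewrite (qfE pT).
Qed.

End Diagonal.

(** * Partial isometries and range projections *)

Section PartialIsometries.
Local Open Scope complex_scope.
Context {R : realType} {H : completeNormedModType R[i]}.
Variable dot : {dot H for (@Num.conj R[i])}.
Hypothesis hd : hilbert_dot dot.
Variable e : nat -> H.
Hypothesis he : orthonormal_basis dot e.
Implicit Types (x y z : H) (f g : nat -> H).
Local Notation n2 := (sqnorm dot).

(** The partial isometry sum_k g_k (x) f_k, sending [f k] to [g k]; [carry f f] is the projection
    onto the closed span of [f]. *)
Definition carry f g x : H := hsum (fun k => dot x (f k)) g.

Lemma osys_norm f al k : osys dot f al -> n2 (f k) = (al k)%:R.
Proof. by move=> of_; rewrite /sqnorm of_ eqxx; case: (al k). Qed.

Lemma osys0 f al k : osys dot f al -> al k = false -> f k = 0.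
Proof. by move=> of_ alk; apply: (@sqnorm_eq0 _ _ dot); rewrite (osys_norm _ of_) alk. Qed.

Section Carry.
Local Open Scope complex_scope.
Variables (f g : nat -> H) (al : pred nat).
Hypotheses (of_ : osys dot f al) (og : osys dot g al).

Lemma carry_cvg x : psum (fun k => dot x (f k)) g @ \oo --> carry f g x.
Proof. exact: (psum_cvg hd og (sqsum_dot of_ x)). Qed.

Lemma dot_carry x k : dot (carry f g x) (g k) = dot x (f k).
Proof.
rewrite /carry (dot_hsum hd og); last exact: sqsum_dot of_ x.
by case alk : (al k); rewrite ?mulr1 // (osys0 of_ alk) dot0r mul0r.
Qed.

Lemma carry_linear : linear (carry f g).
Proof.
move=> a x y; apply: sqnorm_lim_unique (carry_cvg (x := a *: x + y)) _.
have -> : psum (fun k => dot (a *: x + y) (f k)) g =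
  (fun n => a *: psum (fun k => dot x (f k)) g n + psum (fun k => dot y (f k)) g n).
  apply/funext => n; rewrite /psum scaler_sumr -big_split; apply: eq_bigr => k _ /=.
  by rewrite dotDl dotZl scalerDl scalerA.
by apply: cvgD; [apply: cvgZr|]; exact: carry_cvg.
Qed.

Lemma sqnorm_carry_le x : n2 (carry f g x) <= n2 x.
Proof.
apply: (sqnorm_le_lim hd) (carry_cvg (x := x)) _ => n.
rewrite /psum (sqnorm_osum og); apply: le_trans (bessel_fin of_ x n).
by apply: ler_sum => k _; case: (al k); rewrite ?mulr1 ?mulr0 ?sqmod_ge0.
Qed.

Lemma carry_bounded : bounded_op (carry f g).
Proof.
apply/(bounded_opP hd); split; first exact: carry_linear.
by exists 1 => // x; rewrite mul1r sqnorm_carry_le.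
Qed.

Lemma carry_vec k : carry f g (f k) = g k.
Proof.
apply: (sqnorm_lim_unique (carry_cvg (x := f k))); apply/(sqnorm_cvgP hd) => eps e0.
exists k.+1 => n kn; suff -> : psum (fun j => dot (f k) (f j)) g n = g k.
  by rewrite subrr sqnorm0.
rewrite /psum (big_cat_nat (n := k)) //=; last exact: ltnW.
rewrite [X in _ + X]big_ltn // big_nat big1 => [|j /andP[_ jk]]; last first.
  by rewrite of_ gtn_eqF // scale0r.
rewrite big_nat big1 => [|j /andP[kj _]]; last by rewrite of_ ltn_eqF // scale0r.
rewrite of_ eqxx add0r addr0; case alk : (al k); first by rewrite scale1r.
by rewrite scale0r (osys0 og alk).
Qed.

End Carry.

Section CarryAdjoint.
Local Open Scope complex_scope.
Variables (f g h : nat -> H) (al : pred nat).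
Hypotheses (of_ : osys dot f al) (og : osys dot g al) (oh : osys dot h al).

Lemma dot_carry_adj x y : dot (carry f g x) y = dot x (carry g f y).
Proof.
rewrite [RHS]dotC; apply/eqP; rewrite -subr_eq0; apply/eqP/sqmod_small0 => eps e0.
have e4 : 0 < eps / 4 by lra.
have [n [h1 h2]] := ultimately_ex (ultimately_and (cvg_dotl hd y (carry_cvg of_ og (x := x)) e4)
  (cvg_dotl hd x (carry_cvg og of_ (x := y)) e4)).
have E : dot (psum (fun k => dot x (f k)) g n) y =
    Num.conj (dot (psum (fun k => dot y (g k)) f n) x).
  rewrite /psum !dot_suml rmorph_sum; apply: eq_bigr => k _ /=.
  by rewrite !dotZl rmorphM /= -(dotC dot (g k)) -(dotC dot x) mulrC.
have -> : dot (carry f g x) y - Num.conj (dot (carry g f y) x) =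
    - (dot (psum (fun k => dot x (f k)) g n) y - dot (carry f g x) y) +
    Num.conj (dot (psum (fun k => dot y (g k)) f n) x - dot (carry g f y) x).
  by rewrite rmorphB /= -E; ring.
apply: le_lt_trans (sqmodD _ _) _; rewrite sqmod_conj -mulN1r sqmodM.
have -> : sqmod (-1 : R[i]) = 1 by rewrite /sqmod /= oppr0 sqrrN expr1n expr0n addr0.
lra.
Qed.

Lemma adjoint_carry : adjoint dot (carry f g) = carry g f.
Proof.
apply: (adjoint_unique hd he); [exact: carry_bounded of_ og|exact: carry_bounded og of_|].
exact: dot_carry_adj.
Qed.

Lemma carry_comp x : carry g h (carry f g x) = carry f h x.
Proof. by rewrite {1}/carry; congr hsum; apply/funext => k; rewrite (dot_carry of_ og). Qed.

End CarryAdjoint.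

Lemma projection_carry f al : osys dot f al -> projection dot (carry f f).
Proof.
move=> of_; split; first exact: (carry_bounded of_ of_).
  by apply/funext => x /=; exact: (carry_comp f of_ of_).
exact: (adjoint_carry of_ of_).
Qed.

Lemma proj_unique (P Q : H -> H) : projection dot P -> projection dot Q ->
  range P = range Q -> P = Q.
Proof.
move=> [bP PP aP] [bQ QQ aQ] PQ.
have fixP P' y : P' \o P' = P' -> range P' y -> P' y = y.
  by move=> PP' [x _ <-]; have := congr1 (fun u => u x) PP'.
have E x : P (Q x) = Q x by apply: fixP => //; rewrite PQ; exists x.
have E' x : Q (P x) = P x by apply: fixP => //; rewrite -PQ; exists x.
have adP x y : dot (P x) y = dot x (P y) by rewrite (adjointP hd he bP).2 aP.
have adQ x y : dot (Q x) y = dot x (Q y) by rewrite (adjointP hd he bQ).2 aQ.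
apply/funext => x; apply: (dot_ext (dot := dot)) => z.
by rewrite -adP -[P z]E' adQ adP E.
Qed.

Lemma proj_ontoE (P : H -> H) (M : set H) : projection dot P -> range P = M ->
  proj_onto dot M = P.
Proof.
move=> pP <-; apply: xget_unique => // Q [pQ rQ].
exact: proj_unique.
Qed.

Section RangeProjection.
Local Open Scope complex_scope.
Variables (A : H -> H) (f : nat -> H) (s : nat -> R).
Hypotheses (pA : positive_op dot A) (es : eigsys dot A f s).
Let of_ : osys dot f (fun j => 0 < s j) := let: And4 h _ _ _ := es in h.

(** The defect w of [A x] is orthogonal to all [f j], so [A w = 0]; then its squared norm is
    [dot (A x) w = dot x (A w) = 0]. *)
Lemma carry_self_fix x : carry f f (A x) = A x.
Proof.
set z := A x; apply/esym/eqP; rewrite -subr_eq0; apply/eqP/(@sqnorm_eq0 _ _ dot).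
have zf j : dot (z - carry f f z) (f j) = 0 := oproj_perp hd of_ z j.
have [_ _ _ /(_ _ zf) Aw] := es.
rewrite /sqnorm {2}/carry dotBr (perp_hsum hd of_ (sqsum_dot of_ z) zf) subr0.
by rewrite -(pos_selfadj hd pA) Aw dot0l.
Qed.

Lemma range_carry : range (carry f f) = closure (range A).
Proof.
have lA := pos_lin hd pA; have [_ _ Af _] := es.
apply/seteqP; split=> [_ [x _ <-]|y cy].
  move=> B /= hB.
  have [N _ HN] : \forall n \near \oo, B (psum (fun k => dot x (f k)) f n).
    exact: (carry_cvg of_ of_ (x := x)).
  exists (psum (fun k => dot x (f k)) f N); split; last by apply: HN => /=.
  (* Each partial sum is an image under [A] after division by the eigenvalues; where [s k = 0], the
     vector [f k] is 0. *)
  exists (\sum_(0 <= k < N) (dot x (f k) / (s k)%:C) *: f k) => //.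
  rewrite lin_sum //; apply: eq_bigr => k _; rewrite linZ // Af scalerA.
  have [sk|sk] := eqVneq (s k) 0.
    have -> : f k = 0 by apply: (osys0 of_); rewrite sk ltxx.
    by rewrite !scaler0.
  by rewrite divfK // (_ : 0 = 0%:C) // (inj_eq (@complexI R)).
exists y => //; apply/eqP; rewrite -subr_eq0; apply/eqP/(@sqnorm_eq0 _ _ dot)/eqP.
rewrite eq_le sqnorm_ge0 andbT; apply/ler_addgt0Pr => eps e0; rewrite add0r.
have e4 : 0 < eps / 4 by lra.
have [_ [x _ <-] hx] := closureP hd cy e4.
have := sqnorm_tri dot (carry f f y) (A x) y; rewrite (sqnormBC dot (A x)).
rewrite -{1}(carry_self_fix x) -(linB (carry_linear of_ of_)).
by have := sqnorm_carry_le of_ of_ (y - A x); lra.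
Qed.

Lemma range_projE : range_proj dot A = carry f f.
Proof. by apply: proj_ontoE range_carry; exact: (projection_carry of_). Qed.

(** [A] is self-adjoint, so both projections coincide, and the orbit condition says that V is
    isometric on the closed span of [f]. *)
Lemma proj_joinE : proj_join dot (range_proj dot A) (range_proj dot (adjoint dot A)) = carry f f.
Proof.
have -> : adjoint dot A = A.
  apply: (adjoint_unique hd he) => //; [exact: pA.1|exact: pA.1|exact: pos_selfadj].
have E : [set x + y | x in range (carry f f) & y in range (carry f f)] = range (carry f f).
  apply/seteqP; split=> [_ [_ [x _ <-] [_ [y _ <-] <-]]|_ [x _ <-]].
    by exists (x + y) => //; rewrite (linD (carry_linear of_ of_)).
  exists (carry f f x); first by exists x.
  exists 0; last by rewrite addr0.
  by exists 0 => //; rewrite (lin0 (carry_linear of_ of_)).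
rewrite range_projE; apply: proj_ontoE; first exact: (projection_carry of_).
by rewrite E range_carry [LHS](closure_id _).1 //; exact: closed_closure.
Qed.

End RangeProjection.

(** The difference of x and its projection lies in the kernel, so a vector orthogonal to the kernel
    equals its projection. *)
Lemma carry_partial_isometry f g al : osys dot f al -> osys dot g al ->
  partial_isometry dot (carry f g).
Proof.
move=> of_ og; split; first exact: carry_bounded of_ og.
move=> x hx.
have n2E : n2 (carry f g x) = n2 (carry f f x).
  have h1 := sqnorm_cvg hd (carry_cvg of_ og (x := x)).
  have h2 := sqnorm_cvg hd (carry_cvg of_ of_ (x := x)).
  have E : n2 \o psum (fun k => dot x (f k)) g = n2 \o psum (fun k => dot x (f k)) f.
    by apply/funext => n /=; rewrite /psum (sqnorm_osum of_) (sqnorm_osum og).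
  by rewrite E in h1; apply: cvg_unique h1 h2.
have /hx dx : carry f g (x - carry f f x) = 0.
  rewrite (linB (carry_linear of_ og)) -[carry f g (carry f f x)]/(carry f g (carry f f x)).
  by rewrite (carry_comp g of_ of_) subrr.
have zf j : dot (x - carry f f x) (f j) = 0 := oproj_perp hd of_ x j.
have x_eq : x = carry f f x.
  apply/eqP; rewrite -subr_eq0; apply/eqP/(@sqnorm_eq0 _ _ dot).
  rewrite /sqnorm {1}dotBl dx sub0r {1}/carry.
  by rewrite (dotC dot (hsum _ _)) (perp_hsum hd of_ (sqsum_dot of_ x) zf) rmorph0 oppr0.
by apply/eqP; rewrite -(@eqrXn2 _ 2) // !(sqnorm_norm hd) n2E -x_eq.
Qed.

End PartialIsometries.

(** * The expectation of the orbit *)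

Section RealSums.
Context {R : realType}.
Implicit Types (a s xi d : nat -> R).

Lemma cvg_nneseries a (l : R) : (fun n => \sum_(0 <= k < n) a k) @ \oo --> l ->
  (\sum_(0 <= k <oo) (a k)%:E = l%:E)%E.
Proof.
move=> h; apply: cvg_lim => //.
rewrite (_ : (fun n => _) = EFin \o (fun n => \sum_(0 <= k < n) a k)).
  by apply: cvg_EFin => //; exact: nearW.
by apply/funext => n /=; rewrite sumEFin.
Qed.

Lemma nneseries_cvg a (l : R) : (forall k, 0 <= a k) ->
  (\sum_(0 <= k <oo) (a k)%:E = l%:E)%E -> (fun n => \sum_(0 <= k < n) a k) @ \oo --> l.
Proof.
move=> a0 h.
have : cvgn (fun n => (\sum_(0 <= k < n) (a k)%:E)%E).
  by apply: is_cvg_nneseries => n _ _; rewrite lee_fin.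
rewrite h => /fine_cvg; rewrite (_ : _ \o _ = fun n => \sum_(0 <= k < n) a k) //.
by apply/funext => n /=; rewrite sumEFin.
Qed.

Lemma nneseries_unbounded a : (forall k, 0 <= a k) ->
  (\sum_(0 <= k <oo) (a k)%:E = +oo)%E -> unbounded_sums a.
Proof.
move=> a0 h C; apply: contrapT => hn.
have : (\sum_(0 <= k <oo) (a k)%:E <= C%:E)%E.
  apply: lime_le; first by apply: is_cvg_nneseries => n _ _; rewrite lee_fin.
  apply: nearW => n; rewrite sumEFin lee_fin leNgt; apply/negP => hC.
  by apply: hn; exists n.
by rewrite h.
Qed.

Lemma nneseries_rearrange d (kappa : nat -> nat) : (forall k, 0 <= d k) ->
  injective kappa -> (forall k, (forall i, kappa i != k) -> d k = 0) ->
  (\sum_(0 <= k <oo) (d k)%:E = \sum_(0 <= i <oo) (d (kappa i))%:E)%E.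
Proof.
move=> d0 inj off; rewrite !nneseries_esumT; try by move=> n; rewrite lee_fin.
rewrite -(reindex_esum [set: nat] (range kappa) kappa (fun k => (d k)%:E)); last first.
  by split=> [i _|i j _ _|_ [i _ <-]]; [exists i | exact: inj | exists i].
rewrite [RHS]esum_mkcond; apply: eq_esum => k _; case: ifPn => // hk.
rewrite off // => i; apply/negP => /eqP ik; move/negP: hk; apply.
by rewrite -ik inE; exists i.
Qed.

Lemma limn_einf_vanishing (u : nat -> R) : limn_einf (fun n => (u n)%:E) = 0%E ->
  forall c N, 0 < c -> exists2 n, (N <= n)%N & u n < c.
Proof.
move=> h c N c0; apply: contrapT => hn.
have : (c%:E <= limn_einf (fun n => (u n)%:E))%E.
  rewrite limn_einf_lim (cvg_lim _ (cvg_einfs_sup (u := fun n => (u n)%:E))) //.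
  apply: (@le_trans _ _ (einfs (fun n => (u n)%:E) N)); last first.
    by apply: ereal_sup_ubound; exists N.
  apply: le_ereal_inf_tmp => _ [n /= Nn <-]; rewrite lee_fin leNgt.
  by apply/negP => un; apply: hn; exists n.
by rewrite h lee_fin leNgt c0.
Qed.

Lemma cvg_limn_einf0 (u : nat -> R) : u @ \oo --> (0 : R) ->
  limn_einf (fun n => (u n)%:E) = 0%E.
Proof.
move=> h; have : (EFin \o u) @ \oo --> 0%E by apply: cvg_EFin => //; exact: nearW.
by move=> /cvg_limn_einf_sup[].
Qed.

(** Bathtub principle: weights in [0,1] of total at most n do best on the n largest values. The
    weight beyond n is paid at rate at most [s n] and fits into the room left below n. *)
Lemma weighted_sum_le s (c : nat -> R) (n J : nat) : (forall j, 0 <= s j) -> nonincr s ->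
  (forall j, 0 <= c j <= 1) -> \sum_(0 <= j < J) c j <= n%:R -> (n <= J)%N ->
  \sum_(0 <= j < J) s j * c j <= \sum_(0 <= j < n) s j.
Proof.
move=> s0 ni c01 cn nJ.
rewrite (big_cat_nat (n := n)) //= in cn *.
have tail : \sum_(n <= j < J) s j * c j <= s n * \sum_(n <= j < J) c j.
  rewrite mulr_sumr big_nat [leRHS]big_nat; apply: ler_sum => j /andP[nj _].
  by rewrite ler_wpM2r ?ni //; have /andP[] := c01 j.
have tail2 : s n * \sum_(n <= j < J) c j <= s n * (n%:R - \sum_(0 <= j < n) c j).
  by rewrite ler_wpM2l //; lra.
have head : \sum_(0 <= j < n) s j * c j + s n * (n%:R - \sum_(0 <= j < n) c j)
    <= \sum_(0 <= j < n) s j.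
  have -> : n%:R = \sum_(0 <= j < n) (1 : R).
    by rewrite sumr_const_nat subn0.
  rewrite -sumrB mulr_sumr -big_split [leLHS]big_nat [leRHS]big_nat.
  apply: ler_sum => j /andP[_ jn] /=.
  have := ni j n (ltnW jn); have /andP[c0 c1] := c01 j; nra.
rewrite (big_cat_nat (n := n)) //=; lra.
Qed.

Lemma cesaro_small s (c : R) : (forall j, 0 <= s j) -> nonincr s -> to0 s -> 0 < c ->
  exists n, \sum_(0 <= j < n) s j < n%:R * c.
Proof.
move=> s0 ni st0 c0; have c2_gt0 : 0 < c / 2 by lra.
have [N HN] := st0 _ c2_gt0.
set C := \sum_(0 <= j < N) s j.
have C0 : 0 <= C by apply: sumr_ge0.
have [k hk] : exists k : nat, C < k%:R * (c / 2).
  exists (Num.truncn (C / (c / 2))).+1; rewrite -ltr_pdivrMr //; exact: truncnS_gt.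
exists (N + k)%N; rewrite (big_cat_nat (n := N)) ?leq_addr //= -/C.
have : \sum_(N <= j < N + k) s j <= k%:R * (c / 2).
  apply: (@le_trans _ _ (\sum_(N <= j < N + k) (c / 2))).
    rewrite big_nat [leRHS]big_nat; apply: ler_sum => j /andP[Nj _].
    by apply/ltW/HN.
  by rewrite sumr_const_nat addKn mulr_natl.
have N0 : (0 : R) <= N%:R by [].
by rewrite natrD; nra.
Qed.

End RealSums.

(** * The diagonal of a weighted orthonormal system *)

Section SystemDiagonal.
Local Open Scope complex_scope.
Context {R : realType} {H : completeNormedModType R[i]}.
Variable dot : {dot H for (@Num.conj R[i])}.
Hypothesis hd : hilbert_dot dot.
Variable e : nat -> H.
Hypothesis he : orthonormal_basis dot e.
Local Notation n2 := (sqnorm dot).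
Variables (g : nat -> H) (s d : nat -> R).
Hypotheses (cs : co_star s) (og : osys dot g (fun j => 0 < s j)).
Hypothesis dE : forall k,
  (fun n => \sum_(0 <= j < n) s j * sqmod (dot (e k) (g j))) @ \oo --> d k.

Let s0 j : 0 <= s j. Proof. by have [->] := cs. Qed.

Lemma sysdiag_ge0 k : 0 <= d k.
Proof.
apply: (cvgr_to_ge (@dE k)); apply: nearW => n; apply: sumr_ge0 => j _.
by rewrite mulr_ge0 // sqmod_ge0.
Qed.

(** Bessel twice: for the vectors [e (kappa i)] it bounds each weight [c j] by 1, for [g] it bounds
    the total weight by n. *)
Lemma sysdiag_majorized (kappa : nat -> nat) n : injective kappa ->
  \sum_(0 <= i < n) d (kappa i) <= \sum_(0 <= j < n) s j.
Proof.
move=> inj.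
have lim : (fun J => \sum_(0 <= i < n) \sum_(0 <= j < J) s j * sqmod (dot (e (kappa i)) (g j)))
    @ \oo --> \sum_(0 <= i < n) d (kappa i).
  elim: n => [|n IHn].
    by rewrite big_geq //; under eq_fun do rewrite big_geq //; exact: cvg_cst.
  rewrite big_nat_recr //=; under eq_fun do rewrite big_nat_recr //=.
  by apply: cvgD.
apply: (cvgr_to_le lim); exists n => // J /= nJ.
pose c j := \sum_(0 <= i < n) sqmod (dot (e (kappa i)) (g j)).
have -> : \sum_(0 <= i < n) \sum_(0 <= j < J) s j * sqmod (dot (e (kappa i)) (g j)) =
    \sum_(0 <= j < J) s j * c j.
  by rewrite exchange_big /=; apply: eq_bigr => j _; rewrite mulr_sumr.
have oek : osys dot (e \o kappa) predT.
  by move=> i j /=; rewrite he.1 andbT (inj_eq inj).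
apply: weighted_sum_le => //; first by have /co_starP[] := cs.
- move=> j; rewrite sumr_ge0 => [|i _]; last exact: sqmod_ge0.
  apply: le_trans (_ : n2 (g j) <= 1); last first.
    by rewrite (osys_norm _ og); case: (0 < s j).
  apply: le_trans (bessel_fin oek (g j) n); apply: ler_sum => i _ /=.
  by rewrite (dotC dot (g j)) sqmod_conj.
rewrite /c exchange_big /=.
apply: (@le_trans _ _ (\sum_(0 <= i < n) (1 : R))); last first.
  by rewrite sumr_const_nat subn0.
apply: ler_sum => i _; apply: le_trans (bessel_fin og (e (kappa i)) J) _.
by rewrite (sqnorm_basis he).
Qed.

(** Entries at least [c] along a subsequence would, by majorization along it, give n c <= s_0 + ...
    + s_(n-1) for all n, whereas the means of [s] tend to 0. *)
Lemma sysdiag_to0 : to0 d.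
Proof.
move=> c c0; apply: contrapT => hn.
have [N|nu [numono hnu]] := @frequently_subseq (fun n => c <= d n).
  apply: contrapT => hN; apply: hn; exists N => M NM.
  by rewrite ltNge; apply/negP => h; apply: hN; exists M.
have /co_starP[_ ni st0] := cs.
have [n hcn] := cesaro_small s0 ni st0 c0.
have inj : injective nu.
  move=> i j; case: (ltngtP i j) => // /numono; lia.
have := le_lt_trans (sysdiag_majorized n inj) hcn; apply/negP; rewrite -leNgt.
apply: (@le_trans _ _ (\sum_(0 <= i < n) c)).
  by rewrite sumr_const_nat subn0 mulr_natl.
by apply: ler_sum.
Qed.

Lemma sysdiag_sum : (\sum_(0 <= k <oo) (d k)%:E = \sum_(0 <= j <oo) (s j)%:E)%E.
Proof.
transitivity (\sum_(0 <= k <oo) \sum_(0 <= j <oo) (s j * sqmod (dot (e k) (g j)))%:E)%E.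
  by apply: eq_eseriesr => k _; rewrite (cvg_nneseries (@dE k)).
rewrite nneseries_interchange; last first.
  by move=> i j; rewrite lee_fin mulr_ge0 // sqmod_ge0.
apply: eq_eseriesr => j _.
under eq_eseriesr do rewrite EFinM.
rewrite nneseriesZl; last by move=> k _; rewrite lee_fin sqmod_ge0.
have := parseval hd he (x := g j); rewrite (osys_norm _ og) => h.
rewrite (_ : (\sum_(0 <= k <oo) (sqmod (dot (e k) (g j)))%:E)%E = ((0 < s j)%R%:R)%:E).
  rewrite -EFinM; have := s0 j; rewrite le_eqVlt => /orP[/eqP <-|->].
    by rewrite mul0r.
  by rewrite mulr1.
rewrite -(cvg_nneseries h); apply: eq_eseriesr => k _.
by rewrite (dotC dot (g j)) sqmod_conj.
Qed.

End SystemDiagonal.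

(** * The two inclusions *)

Section Main.
Local Open Scope complex_scope.
Context {R : realType} {H : completeNormedModType R[i]}.
Variable dot : {dot H for (@Num.conj R[i])}.
Hypothesis hd : hilbert_dot dot.
Variable e : nat -> H.
Hypothesis he : orthonormal_basis dot e.
Implicit Types (x y z : H).
Local Notation n2 := (sqnorm dot).

Lemma cvg_Re_dot (u : nat -> H) (l y : H) : u @ \oo --> l ->
  (fun n => complex.Re (dot (u n) y)) @ \oo --> complex.Re (dot l y).
Proof.
move=> ul; apply/cvgrPdist_lt => eps e0.
have [N HN] := cvg_dotl hd y ul (exprn_gt0 2 e0); exists N => // n /HN h.
rewrite -(@ltr_pXn2r _ 2) ?nnegrE ?(ltW e0) // real_normK ?num_real //.
apply: le_lt_trans h; apply: le_trans (sqmod_Re _).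
by rewrite raddfB /= -sqrrN opprB.
Qed.

Lemma bounded_comp (S T : H -> H) : bounded_op S -> bounded_op T -> bounded_op (S \o T).
Proof.
move=> /(bounded_opP hd)[lS [M M0 hM]] /(bounded_opP hd)[lT [N N0 hN]].
apply/(bounded_opP hd); split; first by move=> a x y /=; rewrite lT lS.
exists (M * N) => [|x /=]; first exact: mulr_ge0.
by apply: le_trans (hM _) _; rewrite -mulrA ler_wpM2l.
Qed.

Section FixedOperator.
Variables (A : H -> H) (f : nat -> H) (s : nat -> R).
Hypotheses (pA : positive_op dot A) (es : eigsys dot A f s).
Let of_ : osys dot f (fun j => 0 < s j) := let: And4 h _ _ _ := es in h.
Let cs : co_star s := let: And4 _ h _ _ := es in h.

Lemma eig_qf x : (fun n => \sum_(0 <= j < n) s j * sqmod (dot x (f j))) @ \oo --> qform dot A x.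
Proof.
have := cvg_Re_dot (y := x) (eig_expand hd pA es (x := x)).
rewrite [X in X @ _ --> _ -> _](_ : _ = fun n => \sum_(0 <= j < n) s j * sqmod (dot x (f j))) //.
apply/funext => n; rewrite /psum dot_suml Re_sum; apply: eq_bigr => j _.
by rewrite dotZl -mulrA (dotC dot (f j)) -sqmod_mulconj ReM_real.
Qed.

Lemma trace_eig : trace_op dot e A = (\sum_(0 <= j <oo) (s j)%:E)%E.
Proof.
rewrite -(sysdiag_sum hd he (d := fun k => qform dot A (e k)) cs of_) // => k.
exact: eig_qf.
Qed.

Section Orbit.
Variable V : H -> H.
Hypothesis bV : bounded_op V.

Lemma orbit_positive : positive_op dot (V \o A \o adjoint dot V).
Proof.
have [bW hW] := adjointP hd he bV; split.
  by apply: bounded_comp => //; apply: bounded_comp => //; exact: pA.1.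
by move=> x /=; rewrite hW; exact: pA.2.
Qed.

Lemma orbit_diag k :
  (fun n => \sum_(0 <= j < n) s j * sqmod (dot (e k) (V (f j)))) @ \oo -->
  diag_of dot e (V \o A \o adjoint dot V) k.
Proof.
have [bW hW] := adjointP hd he bV.
rewrite /diag_of /= hW; have := eig_qf (x := adjoint dot V (e k)).
rewrite [X in X @ _ --> _ -> _](_ : _ =
  fun n => \sum_(0 <= j < n) s j * sqmod (dot (e k) (V (f j)))) //.
apply/funext => n; apply: eq_bigr => j _; congr (_ * _).
by rewrite dotC sqmod_conj -hW dotC sqmod_conj.
Qed.

Lemma orbit_osys :
  adjoint dot V \o V = proj_join dot (range_proj dot A) (range_proj dot (adjoint dot A)) ->
  osys dot (V \o f) (fun j => 0 < s j).
Proof.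
rewrite (proj_joinE hd he pA es) => VV i j /=.
have [bW hW] := adjointP hd he bV.
have := congr1 (fun u => u (f j)) VV; rewrite /= (carry_vec hd of_ of_) => VVf.
by rewrite hW VVf of_.
Qed.

End Orbit.

Lemma sing_diagop (d : nat -> R) : (forall k, 0 <= d k) -> to0 d ->
  exists kappa : nat -> nat, [/\ injective kappa,
    (forall k, (forall i, kappa i != k) -> d k = 0), co_star (d \o kappa) &
    sing dot (diagop dot e d) = d \o kappa].
Proof.
move=> d0 dt; have [D hD] := to0_bounded d0 dt.
have [ka [inj ni t0 off]] := rearrangement d0 dt.
have es' := diagop_eigsys hd he hD inj ni t0 off.
exists ka; split=> //; first by have [] := es'.
exact: (sing_eig hd (diagop_positive hd he hD) es' he).
Qed.

Lemma trace_class_diagop (d : nat -> R) : (forall k, 0 <= d k) -> to0 d ->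
  trace_class dot e (diagop dot e d) <-> (\sum_(0 <= k <oo) (d k)%:E < +oo)%E.
Proof.
move=> d0 dt; have [D hD] := to0_bounded d0 dt.
have [ka [inj ni t0 off]] := rearrangement d0 dt.
have es' := diagop_eigsys hd he hD inj ni t0 off.
have tE : trace_op dot e (abs_op dot (diagop dot e d)) = (\sum_(0 <= k <oo) (d k)%:E)%E.
  rewrite (abs_op_pos hd (diagop_positive hd he hD) es' he) /trace_op.
  by apply: eq_eseriesr => k _; rewrite (diagop_basis hd he hD) dotZl he.1 eqxx mulr1.
rewrite /trace_class /= tE; split=> [[] //|h]; split=> //.
exact: diagop_bounded hD.
Qed.

Lemma expectation_orbit_sub B : (cond_exp dot e @` orbit_pi dot A) B ->
  exists d : nat -> R, [/\ B = diagop dot e d, forall k, 0 <= d k, to0 d,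
    (\sum_(0 <= k <oo) (d k)%:E = \sum_(0 <= j <oo) (s j)%:E)%E &
    forall kappa n, injective kappa ->
      \sum_(0 <= i < n) d (kappa i) <= \sum_(0 <= j < n) s j].
Proof.
move=> [_ [V [[bV _] VV] <-] <-].
have og := orbit_osys bV VV.
have dE k := orbit_diag bV (k := k).
exists (diag_of dot e (V \o A \o adjoint dot V)); split.
- exact: (cond_expE e (orbit_positive bV)).
- by move=> k; exact: (sysdiag_ge0 cs dE).
- exact: (sysdiag_to0 he cs og dE).
- exact: (sysdiag_sum hd he cs og dE).
- by move=> ka n; exact: (sysdiag_majorized he cs og dE).
Qed.

(** Column j of [U] lists the coefficients of [g j] along the vectors [e (kappa i)]. Basis vectors
    outside the range of [kappa] stay orthogonal to all [g j], which produces the zero entries of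
    the target. *)
Lemma column_osys (U : nat -> nat -> R) (kappa : nat -> nat) : injective kappa ->
  (forall p q, 0 < s p -> 0 < s q -> forall eps : R, 0 < eps ->
    ultimately (fun n => `|(p == q)%:R - \sum_(0 <= i < n) U i p * U i q| <= eps)) ->
  exists g, [/\ osys dot g (fun j => 0 < s j),
    (forall i j, 0 < s j -> dot (e (kappa i)) (g j) = (U i j)%:C) &
    (forall k j, (forall i, kappa i != k) -> dot (e k) (g j) = 0)].
Proof.
move=> inj hU; pose ek := e \o kappa.
have oek : osys dot ek predT by move=> i j; rewrite /ek /= he.1 andbT (inj_eq inj).
have sq j : 0 < s j -> sqsum (fun i => (U i j)%:C).
  (* The Gram sums of a column eventually lie within 1 of 1, and they increase. *)
  move=> sj; exists 2 => n; have [N HN] := hU j j sj sj 1 ltr01.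
  have := HN (maxn n N) (leq_maxr _ _).
  rewrite eqxx (_ : true%:R = 1 :> R) // ler_norml => /andP[h _].
  apply: (@le_trans _ _ (\sum_(0 <= i < maxn n N) U i j * U i j)); last by lra.
  rewrite [leRHS](big_cat_nat (n := n)) ?leq_maxl //=.
  rewrite (_ : \sum_(0 <= k < n) _ = \sum_(0 <= i < n) U i j * U i j); last first.
    by apply: eq_bigr => i _; rewrite sqmod_real expr2.
  by rewrite lerDl sumr_ge0 // => i _; rewrite -expr2 sqr_ge0.
pose g j := if 0 < s j then hsum (fun i => (U i j)%:C) ek else 0.
have dg i j : 0 < s j -> dot (e (kappa i)) (g j) = (U i j)%:C.
  move=> sj; rewrite /g sj dotC (dot_hsum hd oek) ?mulr1; last exact: sq.
  exact: conjc_real.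
exists g; split=> //; last first.
  move=> k j hk; rewrite /g; case: ifP => sj; last by rewrite dot0r.
  apply: (perp_hsum hd oek); first exact: sq.
  by move=> i; rewrite /ek /= he.1 eq_sym (negbTE (hk i)).
move=> p q; rewrite /g; case: ifP => sp; last first.
  by rewrite dot0l andbF.
case: ifP => sq'; last first.
  by rewrite dot0r; case: eqVneq => // pq; rewrite -pq sp in sq'.
rewrite andbT; apply/esym/eqP; rewrite -subr_eq0; apply/eqP/sqmod_small0 => eps e0.
have e4 : 0 < eps / 4 by lra.
have r0 : 0 < Num.sqrt (eps / 4) by rewrite sqrtr_gt0.
have [n [h1 h2]] := ultimately_ex (ultimately_and (hU p q sp sq' _ r0)
  (cvg_dotl hd (g q) (psum_cvg hd oek (sq p sp)) e4)).
have E : dot (psum (fun i => (U i p)%:C) ek n) (g q) =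
    (\sum_(0 <= i < n) U i p * U i q)%:C.
  rewrite /psum dot_suml rmorph_sum; apply: eq_bigr => i _.
  by rewrite dotZl dg // -rmorphM.
move: h2; rewrite E /g sq' => h2.
set S := \sum_(0 <= i < n) _ in h1 h2; set z := dot _ _ in h2 *.
have -> : (p == q)%:R - z = ((p == q)%:R - S)%:C + (S%:C - z).
  by rewrite rmorphB /= rmorph_nat addrA subrK.
apply: le_lt_trans (sqmodD _ _) _; rewrite sqmod_real.
have : ((p == q)%:R - S) ^+ 2 <= eps / 4.
  rewrite -[leRHS](sqr_sqrtr (ltW e4)) -real_normK ?num_real //.
  by rewrite ler_pXn2r // nnegrE // ltW.
lra.
Qed.

Lemma expectation_orbit_sup (B : H -> H) (d : nat -> R) (kappa : nat -> nat) :
  B = diagop dot e d -> (forall k, 0 <= d k) -> injective kappa ->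
  (forall k, (forall i, kappa i != k) -> d k = 0) -> co_star (d \o kappa) ->
  majorized (d \o kappa) s -> fuel (d \o kappa) 0 s ->
  (cond_exp dot e @` orbit_pi dot A) B.
Proof.
move=> BE d0 inj off /co_starP[xi0 xini xit0] maj fl.
have /co_starP[s0 sni st0] := cs.
have [U [rowU colU]] := orthostochastic_realization s0 sni st0 xi0 xini xit0 maj fl.
have [g [og dg dg0]] := column_osys inj colU.
pose V := carry dot f g.
have bV : bounded_op V by exact: (carry_bounded hd of_ og).
have adjV : adjoint dot V = carry dot g f := adjoint_carry hd he of_ og.
exists (V \o A \o adjoint dot V).
  exists V => //; split; first exact: (carry_partial_isometry hd of_ og).
  rewrite (proj_joinE hd he pA es) adjV; apply/funext => x /=.
  exact: (carry_comp hd f of_ og).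
rewrite (cond_expE e (orbit_positive bV)) BE; congr diagop; apply/funext => k.
have lim := orbit_diag bV (k := k).
suff lim' : (fun n => \sum_(0 <= j < n) s j * sqmod (dot (e k) (V (f j)))) @ \oo --> d k.
  exact: cvg_unique lim lim'.
rewrite /V; under eq_fun do under eq_bigr do rewrite (carry_vec hd of_ og).
(* On the range of [kappa] the partial sums are eventually equal to the target because rows have
   exact finite sums; elsewhere both sides are 0. *)
have [[i <-]|nk] := pselect (exists i, kappa i = k).
  have [N HN] := rowU i; apply: cvg_near_cst; exists N => // n /= Nn.
  rewrite -[RHS](HN n Nn); apply: eq_bigr => j _.
  have := s0 j; rewrite le_eqVlt => /orP[/eqP <-|sj]; first by rewrite !mul0r.
  by rewrite dg // sqmod_real expr2.
have hk i : kappa i != k by apply/eqP => ik; apply: nk; exists i.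
rewrite off //; apply: cvg_near_cst; apply: nearW => n.
by rewrite big1 // => j _; rewrite dg0 // sqmod0 mulr0.
Qed.

End FixedOperator.

End Main.

Theorem proposition6p4 (R : realType) (H : completeNormedModType R[i])
    (dot : {dot H for (@Num.conj R[i])}) (e : nat -> H) (A : H -> H) :
  hilbert_dot dot -> orthonormal_basis dot e -> compact_pos dot A ->
  (trace_op dot e A = +oo%E ->
     cond_exp dot e @` orbit_pi dot A =
     [set B | (diagonal_op dot e `&` compact_pos dot) B /\
              majorized (sing dot B) (sing dot A)] `\` trace_class dot e) /\
  ((trace_op dot e A < +oo)%E ->
     cond_exp dot e @` orbit_pi dot A =
     [set B | (diagonal_op dot e `&` compact_pos dot) B /\
              strongly_majorized (sing dot B) (sing dot A)]).
Proof.
move=> hd he [cA pA].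
have [f [s es]] := spectral hd cA pA.
have [_ cs _ _] := es; have /co_starP[s0 _ _] := cs.
have sA : sing dot A = s := sing_eig hd pA es he.
rewrite (trace_eig hd he pA es) sA.
have sub B (d : nat -> R) : (forall k, 0 <= d k) -> to0 d -> B = diagop dot e d ->
    (forall kappa n, injective kappa ->
      \sum_(0 <= i < n) d (kappa i) <= \sum_(0 <= j < n) s j) ->
    (diagonal_op dot e `&` compact_pos dot) B /\ majorized (sing dot B) s.
  move=> d0 dt -> hmaj; have [D hD] := to0_bounded d0 dt.
  have [ka [inj off _ ->]] := sing_diagop hd he d0 dt.
  split; last by move=> n; exact: hmaj.
  split; first exact: (diagop_diagonal hd he hD).
  by split; [exact: (diagop_compact hd he hD) | exact: (diagop_positive hd he hD)].
have sup B : (diagonal_op dot e `&` compact_pos dot) B -> exists (d : nat -> R) kappa,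
    [/\ B = diagop dot e d, forall k, 0 <= d k, to0 d & [/\ injective kappa,
    (forall k, (forall i, kappa i != k) -> d k = 0), co_star (d \o kappa) &
    sing dot B = d \o kappa]].
  move=> [dB [cB pB]]; exists (diag_of dot e B).
  have d0 k : 0 <= diag_of dot e B k by exact: diag_of_ge0.
  have dt := diag_of_to0 hd he dB cB pB.
  have BE := diagonal_diagop hd he dB cB pB.
  have [ka [inj off cx sd]] := sing_diagop hd he d0 dt.
  by exists ka; split=> //; split=> //; rewrite -sd -BE.
split=> tr; apply/seteqP; split=> B.
- move=> /(expectation_orbit_sub hd he pA es)[d [BE d0 dt sumd hmaj]].
  split; first exact: sub BE hmaj.
  (* The diagonal has the same sum as [s], here infinite. *)
  by rewrite BE => /(trace_class_diagop hd he d0 dt); rewrite sumd tr.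
- move=> [[/sup[d [ka [BE d0 dt [inj off cx ->]]]] maj] ntc].
  apply: (expectation_orbit_sup hd he pA es BE d0 inj off cx maj); left.
  apply: nneseries_unbounded => [k|]; first exact: d0.
  (* A finite sum of the diagonal would put B in the trace class. *)
  rewrite -(nneseries_rearrange d0 inj off); apply/eqP; rewrite -leye_eq leNgt.
  by apply/negP => fin; apply: ntc; rewrite BE; apply/(trace_class_diagop hd he d0 dt).
- move=> /(expectation_orbit_sub hd he pA es)[d [BE d0 dt sumd hmaj]].
  have [dc mj] := sub _ _ d0 dt BE hmaj; split=> //; split=> //.
  have [ka [inj off _ sB]] := sing_diagop hd he d0 dt.
  rewrite BE sB; apply: cvg_limn_einf0.
  (* Both series converge to the same finite [L], so the liminf is in fact a limit. *)
  have [L hL] : exists L : R, (\sum_(0 <= j <oo) (s j)%:E)%E = L%:E.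
    exists (fine (\sum_(0 <= j <oo) (s j)%:E)%E); rewrite fineK //.
    by rewrite ge0_fin_numE // nneseries_ge0 // => n _ _; rewrite lee_fin.
  have dL : (fun n => \sum_(0 <= i < n) d (ka i)) @ \oo --> L.
    apply: nneseries_cvg => [k|]; first exact: d0.
    by rewrite -(nneseries_rearrange d0 inj off) sumd.
  have -> : (fun n => \sum_(0 <= j < n) (s j - (d \o ka) j)) =
      (fun n => \sum_(0 <= j < n) s j) - (fun n => \sum_(0 <= i < n) d (ka i)).
    by apply/funext => n; rewrite sumrB.
  by have h := cvgB (nneseries_cvg s0 hL) dL; rewrite subrr in h; exact: (h _).
- move=> [/sup[d [ka [BE d0 dt [inj off cx ->]]]] [maj lim]].
  apply: (expectation_orbit_sup hd he pA es BE d0 inj off cx maj); right => c N c0.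
  have [n Nn hn] := limn_einf_vanishing lim N c0.
  by exists n => //; rewrite /gap; under [X in _ - X]eq_bigr do rewrite add0n; rewrite -sumrB.
Qed.
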